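(* Let $G$ be a graph and let $f:G\to G$ be a vertex map whose linearization $L_f$ has positive entropy $h=h(L_f)>0$. Then for any real $s$ with $0<s<h$ there exist an edge $E$ of $G$ and positive integers $k$ and $n$ such that $\frac{1}{k}\log n>s$ and $E$ has an $n$-horseshoe under $f^k$.
   Context: Graph: a connected space $G$ that is a union of finitely many vertices and finitely many edges $E_1,\dots,E_e$. Each edge is homeomorphic to $[0,1]$, its two boundary points are distinct vertices (no loops), no vertex is an interior point of an edge, and two distinct edges intersect in the empty set, one vertex or two vertices (so several edges may join the same two vertices). Each edge is given unit length via a fixed homeomorphism with $[0,1]$; a path of $m$ edges has length $m$. Vertex map: a continuous map $f:G\to G$ that permutes the vertices of $G$. Linearization: $L_f:G\to G$ agrees with $f$ on vertices, and for each edge $E_i$ with endpoints $V_1,V_2$, $L_f$ maps $E_i$ linearly (i.e. at constant speed with respect to edge length) onto the unique reduced (no backtracking) edge path from $f(V_1)$ to $f(V_2)$ that is homotopic to $f|_{E_i}$ relative to the endpoints of $E_i$. Markov matrix: $M=M(L_f)$ is the $e\times e$ matrix whose entry $M_{i,j}$ is the number of closed subintervals of $E_j$ that $L_f$ maps homeomorphically onto $E_i$ (equivalently, the number of times the edge path $L_f(E_j)$ traverses $E_i$). Entropy: the topological entropy $h(L_f)$ is defined to be $\log\lambda$, where $\lambda$ is the spectral radius of $M(L_f)$. Horseshoe: for a vertex map $g:G\to G$ and positive integers $k,n$, an edge $E$ has an $n$-horseshoe under $g^k$ if there exist closed subintervals $J_1,\dots,J_n$ of $E$, each non-degenerate (with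 non-empty interior), with pairwise disjoint interiors, such that $J_1\cup\dots\cup J_n\subseteq g^k(J_1)\cap\dots\cap g^k(J_n)$. *)

(* Defs.v *)
From HB Require Import structures.
From mathcomp Require Import all_boot all_order all_algebra.
From mathcomp Require Import finmap.
From mathcomp Require Import complex.
From mathcomp Require Import all_classical all_reals all_analysis.

Set Implicit Arguments.
Unset Strict Implicit.
Unset Printing Implicit Defensive.

Import Order.TTheory GRing.Theory Num.Theory.
Import numFieldNormedType.Exports.

Local Open Scope classical_set_scope.
Local Open Scope ring_scope.

(* g maps the subspace A homeomorphically onto the subspace B. *)
Definition homeo_on (X Y : topologicalType) (A : set X) (B : set Y)
    (g : X -> Y) : Prop :=
  [/\ set_bij A B g,
      {within A, continuous g}
    & exists h : Y -> X,
        {within B, continuous h} /\ (forall x, A x -> h (g x) = x)].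

(* The fixed homeomorphism [param i] from [0, 1] onto the i-th edge gives that
   edge unit length; values of [param i] outside [0, 1] are irrelevant.  The
   boundary points [param i 0] and [param i 1] are distinct since [param i] is
   injective on [0, 1].  As a graph is a finite union of metric arcs with the
   topology glued from them, the space is required to be Hausdorff. *)
Record graph (R : realType) := Graph {
  graph_space :> topologicalType;
  vertex : set graph_space;
  n_edges : nat;
  edge : 'I_n_edges -> set graph_space;
  param : 'I_n_edges -> R -> graph_space;
  graph_hausdorff : hausdorff_space graph_space;
  graph_connected : connected [set: graph_space];
  finite_vertex : finite_set vertex;
  graph_cover : [set: graph_space] = vertex `|` \bigcup_i edge i;
  param_homeo : forall i, homeo_on (`[0, 1] : set R) (edge i) (param i);
  vertex_param0 : forall i, vertex (param i 0);
  vertex_param1 : forall i, vertex (param i 1);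
  not_vertex_interior : forall i (t : R), 0 < t < 1 -> ~ vertex (param i t);
  edge_meet : forall i j : 'I_n_edges, i != j ->
    [\/ edge i `&` edge j = set0,
        exists2 v, vertex v & edge i `&` edge j = [set v]
      | exists v w, [/\ vertex v, vertex w, v <> w
                      & edge i `&` edge j = [set v; w]]]
}.

Definition vertex_map (R : realType) (G : graph R) (f : G -> G) : Prop :=
  continuous f /\ set_bij (@vertex R G) (@vertex R G) f.

(* Oriented edges: the flag is [true] for the orientation given by [param] and
   [false] for the opposite one. *)
Definition oedge (R : realType) (G : graph R) : Type :=
  ('I_(n_edges G) * bool)%type.

Definition oparam (R : realType) (G : graph R) (a : oedge G) (t : R) : G :=
  if a.2 then param a.1 t else param a.1 (1 - t).

Fixpoint edge_path (R : realType) (G : graph R) (x : G) (p : seq (oedge G))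
    (y : G) : Prop :=
  if p is a :: q then oparam a 0 = x /\ edge_path (oparam a 1) q y else x = y.

Definition reduced (R : realType) (G : graph R) (p : seq (oedge G)) : bool :=
  sorted (fun a b : 'I_(n_edges G) * bool => b != (a.1, ~~ a.2)) p.

(* c, restricted to [0, 1], runs at constant speed along the edge path p: the
   subinterval [k / m, (k + 1) / m], with m = size p, is mapped affinely onto
   the k-th oriented edge of p. *)
Definition constant_speed (R : realType) (G : graph R) (p : seq (oedge G))
    (c : R -> G) : Prop :=
  forall (k : 'I_(size p)) (u : R), 0 <= u <= 1 ->
    c ((k%:R + u) / (size p)%:R) = oparam (tnth (in_tuple p) k) u.

(* Homotopy, relative to the endpoints, of paths parametrized by [0, 1]. *)
Definition path_homotopic (R : realType) (T : topologicalType)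
    (c d : R -> T) : Prop :=
  exists H : R * R -> T,
    [/\ {within `[0, 1] `*` `[0, 1], continuous H},
        forall t : R, 0 <= t <= 1 -> H (0, t) = c t,
        forall t : R, 0 <= t <= 1 -> H (1, t) = d t
      & forall s : R, 0 <= s <= 1 -> H (s, 0) = c 0 /\ H (s, 1) = c 1].

Definition linearization (R : realType) (G : graph R) (f L : G -> G) : Prop :=
  (forall v, vertex v -> L v = f v) /\
  forall i : 'I_(n_edges G), exists p : seq (oedge G),
    [/\ edge_path (f (param i 0)) p (f (param i 1)),
        reduced p,
        constant_speed p (L \o param i)
      & path_homotopic (f \o param i) (L \o param i)].

Definition subarc (R : realType) (G : graph R) (i : 'I_(n_edges G))
    (a b : R) : set G :=
  param i @` `[a, b].

(* The set of subintervals counted below is finite whenever g is the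
   linearization of a vertex map ([fset_set] is empty on infinite sets). *)
Definition markov_matrix (R : realType) (G : graph R) (g : G -> G) :
    'M[R]_(n_edges G) :=
  \matrix_(i, j)
    #|` fset_set [set J : set G |
          (exists a b : R, [/\ 0 <= a, a <= b, b <= 1 & J = subarc j a b]) /\
          homeo_on J (edge i) g]|%:R.

(* Largest modulus of a complex eigenvalue (0 for the empty matrix). *)
Definition spectral_radius (R : realType) (n : nat) (M : 'M[R]_n) : R :=
  sup [set ComplexField.Normc.normc z |
        z in [set z : R[i]%C | eigenvalue (map_mx (real_complex R) M) z]].

Definition entropy (R : realType) (G : graph R) (g : G -> G) : R :=
  ln (spectral_radius (markov_matrix g)).

(* The edge i has an n-horseshoe under g.  As the intervals are nondegenerate,
   disjointness of their interiors does not depend on whether the interior is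
   taken in the edge or in the real line. *)
Definition has_horseshoe (R : realType) (G : graph R) (g : G -> G) (n : nat)
    (i : 'I_(n_edges G)) : Prop :=
  exists a b : 'I_n -> R,
    [/\ forall l, 0 <= a l /\ a l < b l /\ b l <= 1,
        forall l m : 'I_n, l != m -> `]a l, b l[ `&` `]a m, b m[ = set0
      & \bigcup_l subarc i (a l) (b l) `<=`
        \bigcap_m (g @` subarc i (a m) (b m))].

(* Main.v *)
(* The linearization [L] traverses edge [i] along edge [j] at most as often
   as the reduced path [p j] homotopic to [f] on [j] does. Walks in the
   graph with adjacency lists [p] therefore count compositions of edge
   crossings, and a vector [u >= 0] with [mu u <= u M], obtained from the
   moduli of an eigenvector and chosen with minimal support, has a strongly
   connected support; this forces more than [r ^ k] closed walks of some
   length [k] at some edge, for any [r < mu].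
   The map [f] itself crosses edges at least as often: reading midpoint
   crossings as letters lifts [f] on edge [j] to a path of reduced words,
   whose endpoint is a homotopy invariant and hence equals [p j]. For every
   [l], the last time spent at a vertex before the first [l + 1] letters of
   [p j] are acquired for good starts a genuine crossing, from end to end,
   of the [l]-th edge of [p j]. These crossings have disjoint interiors, and
   by the intermediate value theorem subintervals can be pulled back through
   them, so [f ^ k] has as many laps over an edge as there are closed walks
   of length [k]. *)
Require Import Defs.
From mathcomp Require Import all_boot all_order all_algebra.
From mathcomp Require Import finmap complex.
From mathcomp Require Import all_classical all_reals all_analysis.
From mathcomp Require Import zify ring lra.

Set Implicit Arguments.
Unset Strict Implicit.
Unset Printing Implicit Defensive.

Import Order.TTheory GRing.Theory Num.Theory.
Import numFieldNormedType.Exports.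

Local Open Scope classical_set_scope.
Local Open Scope ring_scope.

(** * Closed walks and the spectral radius *)

Section Walks.
Variables (T : finType) (out : T -> seq T).

(** Entries of the powers of an adjacency matrix: [out j] is a list, so parallel arrows count with
    multiplicity. *)
Fixpoint walks (k : nat) (j i : T) : nat :=
  if k is l.+1 then \sum_(h <- out j) walks l h i else j == i.

Lemma walksD k l j h i :
  (walks k j h * walks l h i <= walks (k + l) j i)%N.
Proof.
elim: k j => [|k IHk] j /=; first by case: eqVneq => [->|]; rewrite ?mul1n.
by rewrite big_distrl /=; apply: leq_sum => x _; exact: IHk.
Qed.

Lemma connect_walks j i :
  connect (fun x y => y \in out x) j i -> exists k, (0 < walks k j i)%N.
Proof.
case/connectP=> q; elim: q j => [|h q IHq] j /=.
  by move=> _ ->; exists 0%N; rewrite /= eqxx.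
case/andP=> jh /IHq{}IHq /IHq[k k_gt0]; exists k.+1 => /=.
by rewrite (big_rem h) //= ltn_addr.
Qed.

Section Growth.
Variables (R : realType) (mu : R).

(* The support of a vector with minimal support is strongly connected: the
   vertices reachable from a given one carry a vector of the same kind. *)
Lemma minimal_subeigenvector (u0 : T -> R) : (forall j, 0 <= u0 j) ->
    (exists j, u0 j != 0) ->
    (forall j, mu * u0 j <= \sum_(h <- out j) u0 h) ->
  exists u : T -> R, [/\ forall j, 0 <= u j, exists j, u j != 0,
      forall j, mu * u j <= \sum_(h <- out j) u h &
      forall i j, u i != 0 -> u j != 0 ->
        connect (fun x y => y \in out x) i j].
Proof.
have [n] := ubnP #|[set j | u0 j != 0]%SET|.
elim: n u0 => // n IHn u lt_n u_ge0 [j0 uj0] le_u.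
have [conn|/existsNP[i /existsNP[j /not_implyP[ui /not_implyP[uj nconn]]]]] :=
  pselect (forall i j, u i != 0 -> u j != 0 ->
    connect (fun x y => y \in out x) i j).
  by exists u; split => //; exists j0.
pose e x y := (y \in out x) && (u y != 0).
have sub_e : subrel (connect e) (connect (fun x y => y \in out x)).
  by apply: connect_sub => x y /andP[xy _]; exact: connect1.
pose v x := if connect e i x then u x else 0.
apply: (IHn v).
- rewrite -ltnS; apply: leq_trans lt_n; rewrite ltnS; apply: proper_card.
  apply/properP; split.
    by apply/fintype.subsetP => x; rewrite !inE /v; case: ifP => //;
      rewrite eqxx.
  (* The vertex [j] leaves the support, since it cannot be reached from [i]. *)
  exists j; rewrite !inE // /v; case: ifP; last by rewrite eqxx.
  by move/sub_e.
- by move=> x; rewrite /v; case: ifP.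
- by exists i; rewrite /v connect0.
move=> x; rewrite [X in mu * X]/v; case: ifP => ix; last first.
  by rewrite mulr0; apply: sumr_ge0 => y _; rewrite /v; case: ifP.
apply: (le_trans (le_u x)); rewrite !big_seq; apply: ler_sum => y xy.
rewrite /v; case: ifPn => // niy.
have [->//|uy] := eqVneq (u y) 0.
by case/negP: niy; apply: connect_trans ix (connect1 _); rewrite /e xy.
Qed.

(** The hypothesis reads [mu u <= A u] for a nonnegative matrix [A], so it iterates. *)
Lemma walks_growth (u : T -> R) k j :
    0 <= mu -> (forall j, mu * u j <= \sum_(h <- out j) u h) ->
  mu ^+ k * u j <= \sum_i (walks k j i)%:R * u i.
Proof.
move=> mu_ge0 le_u; elim: k j => [|k IHk] j /=.
  rewrite expr0 mul1r (bigD1 j) //= eqxx mul1r lerDl.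
  by rewrite big1 // => i /negPf; rewrite eq_sym => ->; rewrite mul0r.
under eq_bigr do rewrite natr_sum mulr_suml.
rewrite exchange_big /= exprSr -mulrA.
apply: le_trans (ler_wpM2l (exprn_ge0 _ mu_ge0) (le_u j)) _.
by rewrite mulr_sumr; apply: ler_sum => h _; exact: IHk.
Qed.

(** If closed walks were bounded by [r ^+ k], every walk from [j] to a vertex [i] of the support
    could be closed by a return walk of fixed length [l i], so that [walks k j i <= r ^+ (k + l i)].
    Then [walks_growth] would bound [(mu / r) ^+ k] by a constant [C]. *)
Lemma closed_walks_growth (u : T -> R) (r : R) : 0 < r -> r < mu ->
    (forall j, 0 <= u j) -> (exists j, u j != 0) ->
    (forall j, mu * u j <= \sum_(h <- out j) u h) ->
  exists i k, (0 < k)%N /\ r ^+ k < (walks k i i)%:R.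
Proof.
move=> r_gt0 r_lt u_ge0 u_neq0 le_u.
have [v [v_ge0 [j vj] le_v conn]] :=
  minimal_subeigenvector u_ge0 u_neq0 le_u.
have mu_gt0 : 0 < mu := lt_trans r_gt0 r_lt.
have vj_gt0 : 0 < v j by rewrite lt_def vj v_ge0.
have /choice[l lP] i : exists l, v i != 0 -> (0 < walks l i j)%N.
  have [vi|] := eqVneq (v i) 0; first by exists 0%N.
  by move=> vi; have /connect_walks[k ?] := conn _ _ vi vj; exists k.
apply: contrapT => small.
have walks_le k : (0 < k)%N -> (walks k j j)%:R <= r ^+ k.
  by move=> k_gt0; rewrite leNgt; apply/negP => lt; apply: small; exists j, k.
pose C := (\sum_i r ^+ l i * v i) / v j.
have bounded k : (0 < k)%N -> (mu / r) ^+ k <= C.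
  move=> k_gt0; rewrite expr_div_n ler_pdivlMr // mulrAC ler_pdivrMr ?exprn_gt0
    //.
  apply: (le_trans (walks_growth k j (ltW mu_gt0) le_v)).
  rewrite mulr_suml; apply: ler_sum => i _; rewrite mulrAC -exprD addnC.
  have [->|vi] := eqVneq (v i) 0; first by rewrite !mulr0.
  apply: ler_wpM2r => //; apply: le_trans (walks_le _ _);
    last by rewrite addn_gt0 k_gt0.
  rewrite ler_nat; apply: leq_trans (walksD k (l i) j i j).
  by rewrite leq_pmulr // lP.
have : 1 < mu / r by rewrite ltr_pdivlMr // mul1r.
move=> q_gt1; have /ln_gt0 := q_gt1; set t := ln _ => t_gt0.
(* With [t = ln (mu / r)], this [k] gives [C < k t < expR (k t) = (mu / r) ^+ k]. *)
pose k := (Num.bound (C / t)).+1.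
have : C < k%:R * t.
  rewrite -ltr_pdivrMr //; apply: lt_le_trans (archi_boundP _) _;
    last by rewrite ler_nat.
  apply: divr_ge0 (ltW t_gt0); apply: le_trans (bounded 1%N isT).
  by rewrite expr1 ltW // divr_gt0.
apply/negP; rewrite -leNgt; apply: le_trans (bounded k isT).
rewrite -[mu / r]lnK ?posrE ?divr_gt0 // -expRM_natl.
by apply: le_trans (expR_ge1Dx _); rewrite lerDr.
Qed.
End Growth.
End Walks.

(** * Moduli of eigenvectors *)

Section SpectralRadius.
Variables (R : realType) (n : nat) (M : 'M[R]_n) (out : 'I_n -> seq 'I_n).
Hypothesis M_count : forall i j, 0 <= M i j <= (count_mem i (out j))%:R.

(** Some eigenvalue [z] has modulus above [r]. The moduli [u] of the entries of a left eigenvector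
    satisfy [|z| u_j <= \sum_i u_i M_ij] by the triangle inequality, and the count bound turns the
    right side into a sum over [out j], as [closed_walks_growth] requires. *)
Lemma spectral_radius_walks (r : R) : 0 < r -> r < spectral_radius M ->
  exists i k, (0 < k)%N /\ r ^+ k < (walks out k i i)%:R.
Proof.
rewrite /spectral_radius => r_gt0; set S := (X in sup X) => r_lt.
(* The value of [sup] on the empty set is 0, which is below [r]. *)
have S0 : S !=set0.
  by apply/set0P/eqP => S0; move: r_lt; rewrite S0 sup0 ltNge ltW.
have [_ [z /= /eigenvalueP[v vM v_neq0] <-] r_lt_z] := sup_gt S0 r_lt.
pose u i := ComplexField.Normc.normc (v ord0 i).
have normc_real (x : R) : ComplexField.Normc.normc (real_complex R x) = `|x|.
  by rewrite /= expr0n addr0 sqrtr_sqr.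
have normc_sum (I : Type) (s : seq I) (F : I -> R[i]%C) :
    ComplexField.Normc.normc (\sum_(i <- s) F i)
      <= \sum_(i <- s) ComplexField.Normc.normc (F i).
  elim/big_rec2: _ => [|i y x _ le_yx];
    first by rewrite ComplexField.Normc.normc0.
  by apply: le_trans (le_normcD _ _) _; rewrite lerD2l.
apply: (closed_walks_growth (u := u) r_gt0 r_lt_z).
- by move=> i; rewrite /u; case: (v ord0 i) => a b; exact: sqrtr_ge0.
- have /existsNP[i vi] : ~ forall i, v ord0 i = 0.
    by move=> v0; case/eqP: v_neq0; apply/rowP => i; rewrite v0 mxE.
  by exists i; apply/eqP => /ComplexField.Normc.eq0_normc.
move=> j; rewrite /u -ComplexField.Normc.normcM.
have := congr1 (fun w : 'rV__ => w ord0 j) vM; rewrite !mxE => <-.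
apply: le_trans (normc_sum _ _ _) _.
have -> : \sum_(h <- out j) ComplexField.Normc.normc (v ord0 h)
    = \sum_i u i * (count_mem i (out j))%:R.
  rewrite /u; elim: (out j) => [|h s IHs] /=.
    by rewrite big_nil big1 // => i _; rewrite mulr0.
  rewrite big_cons IHs [RHS](eq_bigr (fun i => u i * (h == i)%:R
     + u i * (count_mem i s)%:R)); last by move=> i _; rewrite natrD mulrDr.
  rewrite big_split /= [X in _ = X + _](bigD1 h) //= eqxx mulr1.
  rewrite [X in _ = _ + X + _]big1 ?addr0 // => i /negPf.
  by rewrite eq_sym => ->; rewrite mulr0.
apply: ler_sum => i _; rewrite ComplexField.Normc.normcM !mxE.
have /andP[M_ge0 M_le] := M_count i j.
rewrite normc_real ger0_norm //; apply: ler_wpM2l => //.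
by rewrite /u; case: (v ord0 i) => a b; exact: sqrtr_ge0.
Qed.

End SpectralRadius.

(** * Reduced words and monodromy *)

Section Words.
Variable E : eqType.
Implicit Types (a b : E * bool) (p w : seq (E * bool)).

Definition flip a := (a.1, ~~ a.2).

Definition reduced_word w := sorted (fun a b => b != flip a) w.

(* Left multiplication by the generator [a] in the free group on [E]. *)
Definition push a w :=
  if w is b :: w' then if b == flip a then w' else a :: w else [:: a].

Lemma flipK : involutive flip.
Proof. by case=> i b; rewrite /flip negbK. Qed.

Lemma eq_flip a b : (a == flip b) = (b == flip a).
Proof. by apply/eqP/eqP => ->; rewrite flipK. Qed.

Lemma reduced_word_rev w : reduced_word (rev w) = reduced_word w.
Proof.
rewrite /reduced_word rev_sorted; congr (sorted _ w).
by apply/funext => a; apply/funext => b; rewrite eq_flip.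
Qed.

Lemma reduced_push a w : reduced_word w -> reduced_word (push a w).
Proof.
case: w => [|b w] //= w_red; case: ifPn => [_|ba];
  first exact: path_sorted w_red.
by rewrite /reduced_word /= ba.
Qed.

(** Reducedness matters when [a] cancels a head [flip a]: the next letter is then not [a], so
    pushing [flip a] restores the head. *)
Lemma push_flipK a w : reduced_word w -> push (flip a) (push a w) = w.
Proof.
case: w => [|b w] /= w_red; first by rewrite flipK eqxx.
case: eqP => [ba|_] /=; last by rewrite flipK eqxx.
by case: w w_red => [|c w] /=; rewrite ba ?flipK //= => /andP[/negPf ->].
Qed.

Lemma push_reduced a w :
  reduced_word (a :: w) -> push a w = a :: w.
Proof. by case: w => [|b w] //= /andP[/negPf ->]. Qed.

(** Letters are pushed at the head, so [rev] lists them in order of acquisition. A push removes or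
    appends one last letter of [rev w]; a prefix can only appear when the appended letter completes
    it. *)
Lemma push_prefix p w a :
    ~~ prefix p (rev w) -> prefix p (rev (push a w)) ->
  p = rev (push a w) /\ push a w = a :: w.
Proof.
have app u v (x : E * bool) : ~~ prefix u v -> prefix u (rcons v x) ->
  u = rcons v x.
  rewrite !prefixE; have [le_uv|lt_vu] := leqP (size u) (size v).
    by rewrite -cats1 takel_cat // => /negPf ->.
  by move=> _; rewrite take_oversize ?size_rcons // => /eqP.
case: w => [|b w] /=; first by move=> np pw; split => //; exact: (app _ [::]).
case: ifP => _ np pw; last by split => //; move: pw;
  rewrite [rev (a :: _)]rev_cons; exact: app.
case/negP: np; apply: prefix_trans pw _.
by rewrite rev_cons; exact: prefix_rcons.
Qed.

End Words.

(* [loc x] records the open edge containing [x], if any, and on which side of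
   the midpoint of that edge [x] lies; [cross x y] is the action on words of a
   short path from [x] to [y]. *)
Section Monodromy.
Variables (E : eqType) (X : Type) (loc : X -> option (E * bool)).
Implicit Types (x y z : X) (w : seq (E * bool)) (U : set X) (c d : nat -> X).

Definition cross x y w :=
  if (loc x, loc y) is (Some (i, b), Some (j, b')) then
    if (i == j) && (b != b') then push (i, b') w else w
  else w.

(** Either [U] sees at most one side of each edge, as a small star of a vertex does, and no midpoint
    is crossed in it; or [U] lies in one open edge, where crossings depend only on the sides of the
    end points. *)
Definition coherent U :=
  (forall x y i b b', U x -> U y ->
     loc x = Some (i, b) -> loc y = Some (i, b') -> b = b') \/
  exists i, forall x, U x -> exists b, loc x = Some (i, b).

Lemma crossxx x w : cross x x w = w.
Proof. by rewrite /cross; case: (loc x) => [[i b]|] //; rewrite !eqxx. Qed.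

Lemma reduced_cross x y w : reduced_word w -> reduced_word (cross x y w).
Proof.
rewrite /cross; case: (loc x) (loc y) => [[i b]|] [[j b']|] //= w_red.
by case: ifP => // _; exact: reduced_push.
Qed.

(** In the first kind of coherent set every crossing is the identity; in the second, passing a
    midpoint forth and back cancels by [push_flipK]. *)
Lemma cross_trans U x y z w : coherent U -> U x -> U y -> U z ->
  reduced_word w -> cross y z (cross x y w) = cross x z w.
Proof.
move=> [coh|[i coh]] Ux Uy Uz w_red.
  have id_cross s t v : U s -> U t -> cross s t v = v.
    move=> Us Ut; rewrite /cross; move: (coh s t).
    case: (loc s) (loc t) => [[i b]|] [[j b']|] //= /(_ _ _ _ Us Ut).
    by case: eqP => [->|//] /(_ _ _ _ erefl erefl) ->; rewrite eqxx.
  by rewrite !id_cross.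
have [[b1 x_b1] [b2 y_b2] [b3 z_b3]] := And3 (coh _ Ux) (coh _ Uy) (coh _ Uz).
rewrite /cross x_b1 y_b2 z_b3 !eqxx /=.
by case: b1 b2 b3 {x_b1 y_b2 z_b3} => [] [] [] //=;
  [have := push_flipK (i, false) w_red | have := push_flipK (i, true) w_red].
Qed.

Fixpoint monodromy c n w :=
  if n is m.+1 then cross (c m) (c n) (monodromy c m w) else w.

Lemma reduced_monodromy c n w :
  reduced_word w -> reduced_word (monodromy c n w).
Proof. by move=> w_red; elim: n => //= n IHn; exact: reduced_cross. Qed.

Lemma monodromy_cst c n w :
  (forall k, c k = c 0%N) -> monodromy c n w = w.
Proof. by move=> c0; elim: n => //= n ->; rewrite !c0 crossxx. Qed.

Lemma monodromyD c m n w :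
  monodromy c (m + n) w = monodromy (fun k => c (m + k)%N) n (monodromy c m w).
Proof.
by elim: n => [|n IHn]; rewrite ?addn0 //= addnS /= IHn -addnS.
Qed.

Lemma eq_monodromy c d n w : (forall k, (k <= n)%N -> c k = d k) ->
  monodromy c n w = monodromy d n w.
Proof.
elim: n => //= n IHn eq_cd; rewrite !eq_cd ?leqnSn // IHn // => k le_kn.
by rewrite eq_cd // leqW.
Qed.

(** A discrete homotopy: each square between two rungs lies in a coherent set, so by [cross_trans]
    both ways around it act alike. *)
Lemma monodromy_ladder c d n w : reduced_word w ->
    (forall k, (k < n)%N -> exists U, [/\ coherent U,
       U (c k), U (c k.+1), U (d k) & U (d k.+1)]) ->
  monodromy d n (cross (c 0) (d 0) w) = cross (c n) (d n) (monodromy c n w).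
Proof.
move=> w_red; elim: n => //= n IHn close.
rewrite IHn; last by move=> k lt_kn; apply: close; exact: leqW.
have [//|U [cohU Uc Uc' Ud Ud']] := close n.
have red := reduced_monodromy c n w_red.
by rewrite !(cross_trans cohU).
Qed.

Lemma monodromy_coherent U c n w : reduced_word w -> coherent U ->
  (forall k, (k <= n)%N -> U (c k)) -> monodromy c n w = cross (c 0) (c n) w.
Proof.
move=> w_red cohU; elim: n => [|n IHn] Uc /=; first by rewrite crossxx.
rewrite IHn => [|k le_kn]; last by apply: Uc; exact: leqW.
by apply: (cross_trans cohU) => //; apply: Uc; rewrite ?leqnSn.
Qed.

End Monodromy.

(** * Intervals and squares *)

Section RealLine.
Variable R : realType.
Implicit Types (a b u v t : R) (A : set R).

Lemma closed_sup_mem A : closed A -> A !=set0 -> has_ubound A -> A (sup A).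
Proof. by move=> clA A0 ubA; apply: clA; exact: closure_sup. Qed.

Lemma closed_inf_mem A : closed A -> A !=set0 -> has_lbound A -> A (inf A).
Proof.
move=> clA A0 lbA; apply: clA => B /nbhs_ballP[e /= e_gt0 Be].
have [x Ax x_lt] := inf_adherent e_gt0 (conj A0 lbA).
exists x; split => //; apply: Be; rewrite /ball /= distrC ger0_norm.
  by rewrite ltrBlDl.
by rewrite subr_ge0; exact: ge_inf.
Qed.

Lemma closed_within_preimage (X : topologicalType) (g : R -> X) a b
    (D : set X) :
  {within `[a, b], continuous g} -> closed D -> closed (`[a, b] `&` g @^-1` D).
Proof.
move=> /continuous_closedP cg clD.
by rewrite closed_setSI; [exact: cg | exact: interval_closed].
Qed.

(** Take for [b'] the first time at which [g] is [v], and for [a'] the last time before it at which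
    [g] is [u]. Strictly between them neither value is taken, so the intermediate value theorem
    confines [g] to []u, v[]. *)
Lemma itv_pullback (g : R -> R) a b u v : a <= b ->
    {within `[a, b], continuous g} -> g a <= u -> u < v -> v <= g b ->
  exists a' b', [/\ a <= a', a' < b', b' <= b,
    `[u, v] `<=` g @` `[a', b'] & g @` `]a', b'[ `<=` `]u, v[].
Proof.
move=> le_ab cg gau uv vgb.
have cg_sub s t : a <= s -> t <= b -> {within `[s, t], continuous g}.
  move=> le_as le_tb; apply: continuous_subspaceW cg => x /=.
  by rewrite !in_itv /= => /andP[sx xt];
    rewrite (le_trans le_as) // (le_trans xt).
pose B := `[a, b] `&` g @^-1` [set v].
have closed_set1 (x : R) : closed [set x] by [].
have [y yab gy] : exists2 y, y \in `[a, b] & g y = v.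
  by apply: (IVT le_ab cg); rewrite ge_min le_max vgb orbT (le_trans gau) //
    ltW.
have lbB : lbound B a by move=> x [/=]; rewrite in_itv /= => /andP[].
have [/= b'ab gb'] : B (inf B).
  apply: closed_inf_mem; [|by exists y|by exists a].
  exact: closed_within_preimage cg (closed_set1 _).
set b' := inf B in b'ab gb'; move: b'ab; rewrite in_itv /= => /andP[ab' b'b].
have b'_min t : a <= t -> t < b' -> g t <> v.
  move=> le_at lt_tb' gt; suff le : b' <= t by rewrite ltNge le in lt_tb'.
  apply: ge_inf; first by exists a.
  by split=> //=; rewrite in_itv /= le_at (le_trans (ltW lt_tb')).
pose A := `[a, b'] `&` g @^-1` [set u].
have cgb' : {within `[a, b'], continuous g} by exact: cg_sub.
have [z zab' gz] : exists2 z, z \in `[a, b'] & g z = u.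
  by apply: (IVT ab' cgb'); rewrite ge_min le_max gau gb' (ltW uv) orbT.
have ubA : ubound A b' by move=> x [/=]; rewrite in_itv /= => /andP[].
have [/= a'ab' ga'] : A (sup A).
  apply: closed_sup_mem; [|by exists z|by exists b'].
  exact: closed_within_preimage cgb' (closed_set1 _).
set a' := sup A in a'ab' ga'; move: a'ab'; rewrite in_itv /= => /andP[aa' a'b'].
have a'_max t : a' < t -> t <= b' -> g t <> u.
  move=> lt_a't le_tb' gt; suff le : t <= a' by rewrite ltNge le in lt_a't.
  apply: ub_le_sup; first by exists b'.
  by split=> //=; rewrite in_itv /= le_tb' andbT (le_trans aa') // ltW.
have lt_a'b' : a' < b'.
  by rewrite lt_neqAle a'b' andbT; apply: contraTneq uv => a'b'E;
    rewrite -ga' -gb' a'b'E ltxx.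
exists a', b'; split => //.
  move=> w /=; rewrite in_itv /= => /andP[uw wv].
  have [|x xab gx] := IVT (v := w) a'b' (cg_sub a' b' aa' b'b);
    last by exists x.
  by rewrite ga' gb' ge_min le_max uw wv orbT.
move=> _ [t /= + <-]; rewrite !in_itv /= => /andP[a't tb'].
have at_ : a <= t by rewrite (le_trans aa') // ltW.
apply/andP; split; rewrite ltNge; apply/negP => le.
  have [|x] := IVT (v := u) (ltW tb') (cg_sub t b' at_ b'b).
    by rewrite gb' ge_min le_max le (ltW uv) orbT.
  rewrite in_itv /= => /andP[tx xb']; apply: a'_max => //.
  exact: lt_le_trans tx.
have [|x] := IVT (v := v) (ltW a't) (cg_sub a' t aa' (le_trans (ltW tb') b'b)).
  by rewrite ga' ge_min le_max le (ltW uv) orbT.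
rewrite in_itv /= => /andP[a'x xt]; apply: b'_min; first exact: le_trans a'x.
exact: le_lt_trans tb'.
Qed.

End RealLine.

(** Lebesgue's number lemma for a cover pulled back by [H]. In the near-covering form of compactness
    a local bound suffices: if the radius [r] works at [z], then [r / 2] works at all points within
    [r / 2] of [z]. *)
Lemma square_lebesgue_number (R : realType) (X : topologicalType)
    (P : set X -> Prop) (H : R * R -> X) :
    {within `[0, 1] `*` `[0, 1], continuous H} ->
    (forall x : X, exists2 U, P U & nbhs x U) ->
  exists2 e : R, 0 < e & forall z, (`[0, 1] `*` `[0, 1]) z ->
    exists2 U, P U & forall z', (`[0, 1] `*` `[0, 1]) z' ->
      `|z'.1 - z.1| < e -> `|z'.2 - z.2| < e -> U (H z').
Proof.
move=> /subspace_continuousP cH cover; set A := _ `*` _ in cH *.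
pose Q (e : R) (z : R * R) := exists2 U, P U & forall z', A z' ->
  `|z'.1 - z.1| < e -> `|z'.2 - z.2| < e -> U (H z').
have /compact_near_coveringP cA : compact A.
  by apply: compact_setX; exact: segment_compact.
have : \forall e \near (0 : R)^'+, A `<=` Q e.
  apply: cA => z Az; have [U PU nU] := cover (H z).
  have /nbhs_ballP[r /= r_gt0 rU] := cH z Az _ nU.
  near=> x e => /=; exists U => // z' Az' z'1 z'2.
  have xz : ball z (r / 2) x by near: x; apply: nbhsx_ballx; rewrite divr_gt0.
  have e_le : e <= r / 2 by near: e; apply: nbhs_right_le; rewrite divr_gt0.
  apply: rU => //; case: xz; rewrite /ball /= => xz1 xz2.
  split; rewrite /ball /=; [rewrite -(subrKA x.1)|rewrite -(subrKA x.2)];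
    rewrite (le_lt_trans (ler_normD _ _)) // [r]splitr ltrD //.
    by rewrite distrC (lt_le_trans z'1).
  by rewrite distrC (lt_le_trans z'2).
move=> nearQ; near (0 : R)^'+ => e; exists e => //.
by move=> z Az; apply: (near nearQ e).
Unshelve. all: by end_near. Qed.

(** * Topology of graphs *)

Section GraphTopology.
Variables (R : realType) (G : graph R).
Implicit Types (i j : 'I_(n_edges G)) (s t : R) (x v : G) (b : bool).

Lemma param_inj i s t : 0 <= s <= 1 -> 0 <= t <= 1 ->
  param i s = param i t -> s = t.
Proof.
have [[_ inj _] _ _] := param_homeo i => s01 t01 st.
by apply: (inj s t _ _ st); rewrite inE /= in_itv.
Qed.

Lemma paramb_inj i b b' : param i b%:R = param i b'%:R -> b = b'.
Proof.
have b01 (c : bool) : 0 <= (c%:R : R) <= 1 by case: c; rewrite lexx ler01.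
by move=> /(param_inj (b01 b) (b01 b'))/eqP; rewrite eqr_nat;
  case: b b' => [] [].
Qed.

Lemma edge_param i t : 0 <= t <= 1 -> edge i (param i t).
Proof. by have [[fun_ _ _] _ _] := param_homeo i => t01; apply: fun_;
  rewrite /= in_itv. Qed.

Lemma edgeP i x : edge i x -> exists2 t, 0 <= t <= 1 & x = param i t.
Proof.
have [[_ _ surj] _ _] := param_homeo i => /surj[t /=].
by rewrite in_itv => t01 <-; exists t.
Qed.

Lemma vertex_paramb i b : vertex (param i b%:R).
Proof. by case: b; [exact: vertex_param1 | exact: vertex_param0]. Qed.

Lemma vertex_param i t : 0 <= t <= 1 -> vertex (param i t) ->
  exists b, t = b%:R.
Proof.
move=> /andP[t0 t1] vt; move: t0; rewrite le_eqVlt => /predU1P[<-|t0].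
  by exists false.
move: t1; rewrite le_eqVlt => /predU1P[->|t1]; first by exists true.
by case: (@not_vertex_interior _ _ i t); rewrite ?t0 ?t1.
Qed.

Lemma edgeI_vertex i j x : i != j -> edge i x -> edge j x -> vertex x.
Proof.
move=> /edge_meet ij xi xj; have : (edge i `&` edge j) x by [].
by case: ij => [->//|[v vv ->] -> //|[v [w [vv vw _ ->]]] [] ->].
Qed.

Lemma param_interior_neq i j s t : 0 < s < 1 -> 0 <= t <= 1 ->
  param i s = param j t -> i = j.
Proof.
move=> s01 t01 eq_st; apply/eqP;
  apply: contraPT (@not_vertex_interior _ _ _ _ s01).
move=> ij; rewrite not_notE; apply: edgeI_vertex ij _ _.
  by apply: edge_param; case/andP: s01 => ? ?; rewrite !ltW.
by rewrite eq_st; exact: edge_param.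
Qed.

(** The flag [true] marks the half next to [param i 1], midpoint included. Passing the midpoint into
    side [b] thus pushes [(i, b)], the orientation in which [oparam] runs towards [param i b%:R]. *)
Definition loc x : option ('I_(n_edges G) * bool) :=
  [pick ib : 'I_(n_edges G) * bool | `[< exists t,
    [/\ 0 < t < 1, x = param ib.1 t & ib.2 = (2^-1 <= t)] >] ].

Lemma loc_some x i b : loc x = Some (i, b) ->
  exists t, [/\ 0 < t < 1, x = param i t & b = (2^-1 <= t)].
Proof. by rewrite /loc; case: pickP => //= -[j b'] /asboolP /= P [<- <-]. Qed.

Lemma loc_param i t : 0 < t < 1 -> loc (param i t) = Some (i, 2^-1 <= t).
Proof.
move=> t01; rewrite /loc; case: pickP =>
  [[j b] /asboolP /= [s [s01 eq_ts ->]]|].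
  have /andP[/ltW t0 /ltW t1] := t01; have /andP[/ltW s0 /ltW s1] := s01.
  have ji : i = j by apply: param_interior_neq eq_ts; rewrite ?s0.
  by rewrite -ji in eq_ts *; rewrite (param_inj _ _ eq_ts) ?t0 ?s0.
by move=> /(_ (i, 2^-1 <= t)) /asboolP; case; exists t.
Qed.

Lemma loc_vertex x : vertex x <-> loc x = None.
Proof.
split=> [vx|lx].
  case: loc (@loc_some x) => [[i b]|//] /(_ _ _ erefl)[t [t01 xt _]].
  by case: (not_vertex_interior t01 (i := i)); rewrite -xt.
apply: contrapT => nvx; have [|[i _ xi]] : (@vertex _ G `|` \bigcup_i edge i) x
  by rewrite -graph_cover.
  by [].
have [t t01 xt] := edgeP xi.
suff t01' : 0 < t < 1 by move: lx; rewrite xt loc_param.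
have tb b : t != b%:R.
  by apply: contra_notN nvx => /eqP tb; rewrite xt tb; exact: vertex_paramb.
case/andP: t01 => t0 t1.
by rewrite !lt_neqAle t0 t1 eq_sym (tb false) (tb true).
Qed.

Lemma param_closed i (A : set R) : closed A -> A `<=` `[0, 1] ->
  closed (param i @` A).
Proof.
move=> clA A01; apply: compact_closed; first exact: graph_hausdorff.
have [_ c _] := param_homeo i; apply: continuous_compact.
  exact: continuous_subspaceW c.
by apply: subclosed_compact clA _ A01; exact: segment_compact.
Qed.

Lemma edge_closed i : closed (edge i).
Proof.
have -> : edge i = param i @` `[0, 1].
  apply/seteqP; split => [x /edgeP[t t01 ->]|_ [t /= t01 <-]].
    by exists t => //=; rewrite in_itv.
  by apply: edge_param; rewrite in_itv in t01.
by apply: param_closed => //; exact: interval_closed.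
Qed.

Lemma finite_closed (A : set G) : finite_set A -> closed A.
Proof.
have /hausdorff_accessible := @graph_hausdorff _ G.
by move=> /accessible_finite_set_closed; exact.
Qed.

Definition open_edge i : set G := [set x | exists b, loc x = Some (i, b)].

(** Its complement consists of the vertices and the other edges, a finite union of closed sets. *)
Lemma open_edge_open i : open (open_edge i).
Proof.
have -> : open_edge i = ~` (@vertex _ G `|` \bigcup_(j in [set j | j != i])
  edge j).
  apply/seteqP; split => [x [b lx]|x nx].
    case=> [/loc_vertex|[j /= ji xj]]; first by rewrite lx.
    have [t [t01 xt _]] := loc_some lx.
    have [s s01 xs] := edgeP xj; case/eqP: ji.
    by rewrite (param_interior_neq t01 s01 (etrans (esym xt) xs)).
  have [vx|] := pselect (vertex x); first by case: nx; left.
  case lx: (loc x) => [[j b]|]; last by move/loc_vertex: lx.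
  move=> _.
  have [ji|ij] := eqVneq j i; first by exists b; rewrite lx ji.
  case: nx; right; exists j => //.
  have [t [/andP[t0 t1] -> _]] := loc_some lx.
  by apply: edge_param; rewrite !ltW.
rewrite openC; apply: closedU; first by apply: finite_closed;
  exact: finite_vertex.
by apply: closed_bigcup => [|j _]; [exact: finite_finset | exact: edge_closed].
Qed.

(** By the second clause, when a path passes inside [U] between a vertex and an open edge, the half
    edge on which it is seen determines the vertex. *)
Definition good (U : set G) := coherent loc U /\
  forall v x i b, U v -> vertex v -> U x -> loc x = Some (i, b) ->
    v = param i b%:R.

(** An open edge contains no vertex and serves for its own points. The star of a vertex [x] meets an
    open edge only on a side ending at [x]; this side is unique because the two ends of an edge
    differ. *)
Lemma good_cover x : exists2 U, good U & nbhs x U.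
Proof.
case lx: (loc x) => [[i b]|].
  exists (open_edge i); last by apply: open_nbhs_nbhs; split;
    [exact: open_edge_open|exists b].
  split; first by right; exists i.
  by move=> v y j c [b' lv] /loc_vertex; rewrite lv.
have vx : vertex x by exact/loc_vertex.
(* the open star of [x] in the barycentric subdivision *)
pose C i := `[0, 1] `&` [set t : R |
  (param i 0 = x -> 2^-1 <= t) /\ (param i 1 = x -> t <= 2^-1)].
pose U := ~` ((@vertex _ G `\` [set x]) `|` \bigcup_i (param i @` C i)).
have locU y i b : U y -> loc y = Some (i, b) -> x = param i b%:R.
  move=> Uy ly; apply: contrapT => xb; apply: Uy; right; exists i => //.
  have [t [t01 -> bt]] := loc_some ly; exists t => //; rewrite /C /= in_itv /=.
  case/andP: t01 => /ltW t0 /ltW t1; rewrite t0 t1; split => //.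
  case: b bt xb {ly} => /esym; last first.
    by move/negbT; rewrite -ltNge => /ltW t2 xb; split => [/esym//|].
  by move=> t2 xb; split => // /esym.
exists U; last first.
  apply: open_nbhs_nbhs; split.
    rewrite openC; apply: closedU.
      by apply: finite_closed; apply: finite_setD; exact: finite_vertex.
    apply: closed_bigcup => [|i _]; first exact: finite_finset.
    apply: param_closed => [|t []//]; apply: closedI;
      first exact: interval_closed.
    have closed_imp (p : Prop) (B : set R) : 
        closed B -> closed [set t | p -> B t].
      have [hp|np] := pselect p => clB.
        by rewrite (_ : mkset _ = B) //; apply/seteqP; split => t /=;
          [move/(_ hp)|].
      by rewrite (_ : mkset _ = setT) //; apply/seteqP; split => t //= _ /np.
    apply: (@closedI _ [set t | _ -> _] [set t | _ -> _]); apply: closed_imp.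
      exact: closed_ge.
    exact: closed_le.
  case=> [[_ /= /(_ erefl)]//|[i _ [t [/=]]]].
  rewrite in_itv /= => t01 [h0 h1] xt.
  have [[] tb] : exists b, t = b%:R by apply: (vertex_param (i := i) t01);
    rewrite xt.
    by move: h1; rewrite -xt tb /= => /(_ erefl); lra.
  by move: h0; rewrite -xt tb /= => /(_ erefl); lra.
split.
  left=> y z i b b' Uy Uz ly lz.
  by have := locU _ _ _ Uz lz; rewrite (locU _ _ _ Uy ly) => /paramb_inj.
move=> v y i b Uv vv Uy ly; rewrite -(locU _ _ _ Uy ly).
by apply: contrapT => vx'; apply: Uv; left.
Qed.

End GraphTopology.

(** * Lifting paths to words *)

Section Lifting.
Variables (R : realType) (G : graph R).
Implicit Types (c d : R -> G) (t : R).

(* [S t] is the word in the free group on the edges spelled by [c] on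
   [0, t]; at [t = 1] it only depends on the homotopy class of [c]. *)
Lemma path_lift c d : path_homotopic c d ->
  exists e (N0 : nat), 0 < e /\ forall N, (N0 <= N)%N -> (0 < N)%N ->
  exists S : R -> seq ('I_(n_edges G) * bool),
  [/\ S 0 = [::], S 1 = monodromy (@loc R G) (fun k => d (k%:R / N%:R)) N [::],
      forall t, 0 <= t <= 1 -> reduced_word (S t) &
      forall t t', 0 <= t <= 1 -> 0 <= t' <= 1 -> `|t' - t| < e ->
        exists2 U, good U &
        [/\ U (c t), U (c t') & S t' = cross (@loc R G) (c t) (c t') (S t)]].
Proof.
case=> H [cH H0 H1 Hend].
have [e e_gt0 He] := square_lebesgue_number cH (@good_cover R G).
(* Here [e] is a Lebesgue number. Points of one ladder square differ by a sampling step, below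
   [e / 2] as [2 / e < N], plus a shift of at most [e / 2]. *)
exists (e / 2), (Num.bound (2 / e)); split; first by rewrite divr_gt0.
move=> N leN N_gt0.
have N_gt0R : 0 < N%:R :> R by rewrite ltr0n.
have N1e : N%:R^-1 < e / 2.
  rewrite invf_plt ?posrE ?divr_gt0 // invf_div.
  apply: lt_le_trans (archi_boundP _) _; first by rewrite divr_ge0 // ltW.
  by rewrite ler_nat.
have N01 (k : nat) : (k <= N)%N -> 0 <= (k%:R / N%:R : R) <= 1.
  by move=> le_kN; rewrite divr_ge0 //= ler_pdivrMr // mul1r ler_nat.
have HeU (s t : R) : 0 <= s <= 1 -> 0 <= t <= 1 -> exists2 U, good U &
    forall s' t', 0 <= s' <= 1 -> 0 <= t' <= 1 -> `|s' - s| < e ->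
      `|t' - t| < e -> U (H (s', t')).
  move=> s01 t01; have [|U gU HU] := He (s, t); first by split;
    rewrite /= in_itv.
  by exists U => // s' t' s'01 t'01 ? ?; apply: HU => //; split;
    rewrite /= in_itv.
(* For every [t], the arc of [c] up to [t] is sampled with the same number [N] of steps, so close
   times give ladders. *)
pose x (t : R) (k : nat) := c (t * (k%:R / N%:R)).
exists (fun t => monodromy (@loc R G) (x t) N [::]).
have step_lt : `|N%:R^-1| < e :> R.
  by rewrite ger0_norm ?invr_ge0 //; apply: lt_le_trans N1e _;
    rewrite ler_pdivrMr //; lra.
split.
- by apply: monodromy_cst => k; rewrite /x !mul0r.
(* Adjacent rows of the square form a ladder, whose end crossings are trivial because the homotopy
   fixes the end points. So row 0, which samples [c], and row [N], which samples [d], spell the same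
   word. *)
- pose y (r k : nat) := H (r%:R / N%:R, k%:R / N%:R).
  have y_row r : (r <= N)%N ->
      monodromy (@loc R G) (y r) N [::] = monodromy (@loc R G) (y 0%N) N [::].
    elim: r => // r IHr lt_rN; rewrite -IHr 1?ltnW //.
    have y0 s : (s <= N)%N -> y s 0%N = c 0.
      by move=> le_sN; rewrite /y mul0r; case: (Hend _ (N01 _ le_sN)).
    have y1 s : (s <= N)%N -> y s N = c 1.
      by move=> le_sN; rewrite /y divff ?gt_eqF //;
        case: (Hend _ (N01 _ le_sN)).
    have := @monodromy_ladder _ _ (@loc R G) (y r) (y r.+1) N [::] isT.
    rewrite !y0 // 1?ltnW // crossxx !y1 // 1?ltnW // crossxx; apply.
    move=> k lt_kN; have [U gU HU] :=
      HeU _ _ (N01 r (ltnW lt_rN)) (N01 k (ltnW lt_kN)).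
    have near0 (a : R) : `|a - a| < e by rewrite subrr normr0.
    have near1 (a : nat) : `|a.+1%:R / N%:R - a%:R / N%:R| < e :> R.
      by rewrite -mulrBl -natrB // subSnn mul1r.
    have [cohU _] := gU.
    by exists U; split => //; apply: HU; rewrite ?N01 // ltnW.
  transitivity (monodromy (@loc R G) (y 0%N) N [::]).
    by apply: eq_monodromy => k le_kN; rewrite /x /y mul1r mul0r H0 ?N01.
  rewrite -(y_row N) //; apply: eq_monodromy => k le_kN.
  by rewrite /y divff ?gt_eqF // H1 ?N01.
- by move=> t _; exact: reduced_monodromy.
move=> t t' t01 t'01 tt'.
have x_end (s : R) : x s N = c s by rewrite /x divff ?gt_eqF // mulr1.
have xk01 (s : R) k : (k <= N)%N -> 0 <= s <= 1 -> 0 <= s * (k%:R / N%:R) <= 1.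
  move=> /N01 /andP[k0 k1] /andP[s0 s1]; rewrite mulr_ge0 //=.
  exact: mulr_ile1.
have z01 : 0 <= (0 : R) <= 1 by rewrite lexx ler01.
have near0 (a : R) : `|a - a| < e by rewrite subrr normr0.
have [U gU HU] := HeU 0 t z01 t01; exists U => //; split.
- by rewrite -H0 //; apply: HU; rewrite ?near0.
- rewrite -H0 //; apply: HU; rewrite ?near0 //.
  by apply: lt_le_trans tt' _; rewrite ler_pdivrMr //; lra.
have ladder k : (k < N)%N -> exists U, [/\ coherent (@loc R G) U,
    U (x t k), U (x t k.+1), U (x t' k) & U (x t' k.+1)].
  move=> lt_kN; have le_kN := ltnW lt_kN.
  have [V gV HV] := HeU 0 _ z01 (xk01 t k le_kN t01).
  have HcV (s : R) : 0 <= s <= 1 -> `|s - t * (k%:R / N%:R)| < e -> V (c s).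
    by move=> s01 ?; rewrite -H0 //; apply: HV.
  have kS : (k.+1%:R / N%:R : R) = k%:R / N%:R + N%:R^-1.
    by rewrite -addn1 natrD mulrDl mul1r.
  have /andP[p0 p1] := N01 _ le_kN.
  have q0 : 0 <= N%:R^-1 :> R by rewrite invr_ge0 ltW.
  have dist (a b : R) : `|b| <= e / 2 -> 0 <= a <= 1 ->
    `|a * N%:R^-1 + b * (k%:R / N%:R)| < e.
    move=> b_le /andP[a0 a1]; rewrite [e]splitr.
    apply: le_lt_trans (ler_normD _ _) _; apply: ltr_leD.
      apply: le_lt_trans N1e; rewrite ger0_norm ?mulr_ge0 //.
      by rewrite -[leRHS]mul1r ler_wpM2r.
    by rewrite normrM (ger0_norm p0) -[leRHS]mulr1 ler_pM.
  have e2 : 0 <= e / 2 by rewrite divr_ge0 ?ltW.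
  exists V; split; [by case: gV| | | |]; rewrite /x; apply: HcV;
    rewrite ?xk01 //.
  - by rewrite kS (_ : _ - _ = t * N%:R^-1 + 0 * (k%:R / N%:R)) ?dist ?normr0
      //; ring.
  - rewrite (_ : _ - _ = 0 * N%:R^-1 + (t' - t) * (k%:R / N%:R)); last by ring.
    by rewrite dist ?lexx ?ler01 // ltW.
  rewrite kS (_ : _ - _ = t' * N%:R^-1 + (t' - t) * (k%:R / N%:R));
    last by ring.
  by rewrite dist // ltW.
have := @monodromy_ladder _ _ _ _ _ _ [::] isT ladder.
by rewrite !x_end /x !mul0r !mulr0 crossxx.
Qed.

End Lifting.

(** * Words spelled by edge paths *)

Section Crossings.
Variables (R : realType) (G : graph R).
Implicit Types (a : oedge G) (p : seq (oedge G)) (t : R).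

Lemma vertex_oparam0 a : vertex (oparam a 0).
Proof. by case: a => i [] /=; rewrite /oparam /= ?subr0;
  [exact: vertex_param0|exact: vertex_param1]. Qed.

Lemma vertex_oparam1 a : vertex (oparam a 1).
Proof. by case: a => i [] /=; rewrite /oparam /= ?subrr;
  [exact: vertex_param1|exact: vertex_param0]. Qed.

Lemma loc_oparam a t : 0 < t < 1 -> t != 2^-1 ->
  loc (oparam a t) = Some (a.1, (2^-1 < t) == a.2).
Proof.
case: a => i [] t01 t2; rewrite /oparam /= loc_param //.
- by congr (Some (_, _)); rewrite le_eqVlt eq_sym (negPf t2) eqb_id.
- congr (Some (_, _)); rewrite eqbF_neg -leNgt.
  by apply/idP/idP; lra.
by case/andP: t01 => t0 t1; apply/andP; split; lra.
Qed.

(** The end samples are vertices and contribute nothing; the others stay in one open edge, so only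
    the sides of the first and the last of them count. As [2 < q], these two lie strictly on
    opposite sides of the midpoint. *)
Lemma monodromy_oparam a (q : nat) w : (2 < q)%N -> reduced_word w ->
  monodromy (@loc R G) (fun k => oparam a (k%:R / q%:R)) q w = push a w.
Proof.
case: q => [|[|q]] // q_gt0 w_red; set c := fun k => _.
have q2 : (0 : R) < q.+2%:R by rewrite ltr0n.
have c0 : loc (c 0%N) = None.
  by apply/loc_vertex; rewrite /c mul0r; exact: vertex_oparam0.
have c1 : loc (c q.+2) = None.
  by apply/loc_vertex; rewrite /c divff ?gt_eqF //; exact: vertex_oparam1.
have cross0 x y v : loc x = None \/ loc y = None -> cross (@loc R G) x y v = v.
  by rewrite /cross => -[->|->] //; case: (loc x) => [[]|].
have c_in k : (k <= q)%N -> 0 < k.+1%:R / (q.+2%:R : R) < 1.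
  by move=> le_kq; rewrite divr_gt0 ?ltr0n // ltr_pdivrMr // mul1r ltr_nat
    !ltnS.
have cohE : coherent (@loc R G) (open_edge a.1) by right; exists a.1.
have cE k : (k <= q)%N -> open_edge a.1 (c k.+1).
  move=> /c_in; set t := (_ / _); rewrite /c -/t /oparam => /andP[t0 t1].
  by case: (a.2); eexists; apply: loc_param; apply/andP; split; lra.
rewrite (_ : q.+2 = 1 + q + 1)%N; last by rewrite addn1.
have mono1 x v : monodromy (@loc R G) x 1 v = cross (@loc R G) (x 0%N) (x 1%N)
  v.
  by [].
rewrite !monodromyD !mono1 !cross0; [|by left|by right; rewrite addn1].
rewrite (monodromy_coherent w_red cohE) // addn0 /cross /c.
have q2' : (2 : R) < q.+2%:R by rewrite ltr_nat.
have e1 : 1%:R / (q.+2%:R : R) < 2^-1.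
  by rewrite ltr_pdivrMr // ltr_pdivlMl // mulr1.
have e2 : 2^-1 < q.+1%:R / (q.+2%:R : R).
  by rewrite ltr_pdivlMr // ltr_pdivrMl // -natrM ltr_nat mul2n -addnn; lia.
rewrite add1n !loc_oparam ?c_in //; last 2 first.
- by rewrite gt_eqF.
- by rewrite lt_eqF.
rewrite e2 (lt_gtF e1) eqxx /=.
by case: a {c c0 c1 c_in cohE cE} => i [].
Qed.

(** Each block of [q] samples pushes the next letter of [p], and since [p] is reduced no push
    cancels. *)
Lemma constant_speed_monodromy (c : R -> G) p q : constant_speed p c ->
  reduced p -> (2 < q)%N ->
  monodromy (@loc R G) (fun k =>
    c (k%:R / (size p * q)%:R)) (size p * q) [::] = rev p.
Proof.
move=> cp p_red q_gt2; set x := fun k => _.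
suff mono j : (j <= size p)%N ->
  monodromy (@loc R G) x (j * q) [::] = rev (take j p).
  by rewrite mono // take_size.
elim: j => [|j IHj] lt_jp; first by rewrite take0.
rewrite (mulSnr j q) monodromyD (IHj (ltnW lt_jp)).
have q_gt0 : 0 < q%:R :> R by rewrite ltr0n (ltn_trans _ q_gt2).
have p_gt0 : 0 < (size p)%:R :> R by rewrite ltr0n (leq_trans _ lt_jp).
pose a := tnth (in_tuple p) (Ordinal lt_jp).
have rcons_a : take j.+1 p = rcons (take j p) a.
  by rewrite (take_nth a lt_jp); congr rcons; exact/esym/(tnth_nth a).
rewrite (@eq_monodromy _ _ _ _ (fun k => oparam a (k%:R / q%:R))) => [|k le_kq].
  rewrite monodromy_oparam //; last first.
    by rewrite reduced_word_rev; exact: take_sorted.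
  rewrite rcons_a rev_rcons push_reduced //.
  by rewrite -rev_rcons -rcons_a reduced_word_rev; exact: take_sorted.
rewrite /x -(cp (Ordinal lt_jp)) /=; last first.
  by rewrite divr_ge0 //= ler_pdivrMr // mul1r ler_nat.
by congr c; rewrite natrD !natrM; field; rewrite !gt_eqF.
Qed.

End Crossings.

(** * A genuine crossing extracted from the lifted word *)

Section LastCrossing.
Variables (R : realType) (G : graph R) (c : R -> G).
Variables (e : R) (S : R -> seq ('I_(n_edges G) * bool)).
Hypotheses (c_cont : {within `[0, 1], continuous c}) (e_gt0 : 0 < e).
Hypotheses (c0 : vertex (c 0)) (c1 : vertex (c 1)).
Hypothesis S_red : forall t, 0 <= t <= 1 -> reduced_word (S t).
Hypothesis S_lift : forall t t', 0 <= t <= 1 -> 0 <= t' <= 1 -> `|t' - t| < e ->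
  exists2 U, good U &
  [/\ U (c t), U (c t') & S t' = cross (@loc R G) (c t) (c t') (S t)].

Let S_vertex t t' : 0 <= t <= 1 -> 0 <= t' <= 1 -> `|t' - t| < e ->
  vertex (c t) \/ vertex (c t') -> S t' = S t.
Proof.
move=> t01 t'01 /(S_lift t01 t'01)[U _ [_ _ ->]] vtt'.
by case: vtt' => /loc_vertex v; rewrite /cross v //; case: (loc (c t)) => [[]|].
Qed.

(** The lifting property only compares times closer than [e]; a longer stretch is cut into such
    steps, which compose because an open edge is coherent. *)
Let S_open_edge i (s s' : R) : 0 <= s -> s' <= 1 ->
    (forall t, s < t < s' -> open_edge i (c t)) ->
  forall t t', s < t -> t <= t' -> t' < s' ->
  S t' = cross (@loc R G) (c t) (c t') (S t).
Proof.
move=> s0 s'1 cE t t' st tt' t's'.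
have cohE : coherent (@loc R G) (open_edge i) by right; exists i.
have in01 r : t <= r -> r <= t' -> 0 <= r <= 1.
  by move=> tr rt'; apply/andP; split; lra.
have inE r : t <= r -> r <= t' -> open_edge i (c r).
  by move=> tr rt'; apply: cE; apply/andP; split; lra.
pose N := (Num.bound ((t' - t) / e)).+1.
have N_gt0 : 0 < N%:R :> R by rewrite ltr0n.
have step : (t' - t) / N%:R < e.
  rewrite ltr_pdivrMr // mulrC -ltr_pdivrMr //.
  apply: lt_le_trans (archi_boundP _) _; last by rewrite ler_nat.
  by rewrite divr_ge0 ?subr_ge0 // ltW.
pose r (k : nat) := t + k%:R * ((t' - t) / N%:R).
have step0 : 0 <= (t' - t) / N%:R by rewrite divr_ge0 ?subr_ge0 // ltW.
have r_in k : (k <= N)%N -> t <= r k <= t'.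
  move=> le_kN; rewrite /r lerDl mulr_ge0 //= -lerBrDl mulrA ler_pdivrMr //.
  by rewrite [leLHS]mulrC; apply: ler_wpM2l; rewrite ?subr_ge0 ?ler_nat.
suff rS k : (k <= N)%N -> S (r k) = cross (@loc R G) (c t) (c (r k)) (S t).
  have := rS N (leqnn N); rewrite (_ : r N = t') // /r [N%:R * _]mulrC divfK
    ?gt_eqF //.
  by rewrite addrC subrK.
elim: k => [_|k IHk lt_kN]; first by rewrite /r mul0r addr0 crossxx.
have /andP[k1 k2] := r_in _ (ltnW lt_kN); have /andP[k3 k4] := r_in _ lt_kN.
have [|U _ [_ _ ->]] := S_lift (in01 _ k1 k2) (in01 _ k3 k4).
  rewrite /r -natr1 mulrDl mul1r (_ : _ - _ = (t' - t) / N%:R); last by ring.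
  by rewrite ger0_norm.
rewrite (IHk (ltnW lt_kN)); apply: (cross_trans cohE); try exact: inE.
by apply: S_red; apply: in01.
Qed.

(** Let [s] be the last time spent at a vertex with [Q] false, and [s'] the next time spent at a
    vertex. The word is constant near vertex times, so [s] is attained and [s'] is not close to it.
    In between [c] stays in one open edge, and since [Q] changes, the midpoint must be passed: [c]
    runs from one end to the other. *)
Lemma last_crossing (Q : seq ('I_(n_edges G) * bool) -> Prop) : ~ Q (S 0) ->
  Q (S 1) ->
  exists s s' (a : oedge G),
  [/\ [/\ 0 <= s, s < s' & s' <= 1],
      forall t, 0 <= t <= 1 -> vertex (c t) -> ~ Q (S t) -> t <= s,
      [/\ c s = oparam a 0, c s' = oparam a 1 & c @` `[s, s'] `<=` edge a.1],
      ~ Q (S s) & Q (S s') /\ S s' = push a (S s)].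
Proof.
move=> Q0 Q1.
pose Z := `[0, 1] `&` c @^-1` @vertex _ G.
have Z01 t : Z t -> 0 <= t <= 1 by case=> /=; rewrite in_itv.
have clZ : closed Z.
  by apply: closed_within_preimage => //; apply: finite_closed;
    exact: finite_vertex.
have inZ t : 0 <= t <= 1 -> vertex (c t) -> Z t by move=> t01 vt; split;
  rewrite //= in_itv.
pose A := Z `&` [set t | ~ Q (S t)].
have A0 : A 0 by split => //; apply: inZ; rewrite ?lexx ?ler01.
have ubA : ubound A 1 by move=> t [/Z01/andP[]].
have supA : has_sup A by split; [exists 0 | exists 1].
pose s := sup A.
have Zs : Z s.
  apply: clZ; apply: (closureS (@subIsetl _ Z _)); apply: closure_sup;
    [by exists 0|by exists 1].
have A_le t : A t -> t <= s by apply: ub_le_sup; exists 1.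
have nQs : ~ Q (S s).
  have [t At ts] := sup_adherent e_gt0 supA; have [Zt nQt] := At.
  rewrite (@S_vertex t s) ?Z01 //; last by left; case: Zt.
  by rewrite -/s in ts; rewrite ger0_norm ?subr_ge0 ?A_le //; lra.
have s0 : 0 <= s by apply: A_le.
have Z_gap t : Z t -> s < t -> s + e <= t.
  move=> Zt st; rewrite leNgt; apply/negP => te; have := st;
    rewrite ltNge A_le //.
  split => //; rewrite /= (@S_vertex s t) ?Z01 //; last by left; case: Zs.
  by rewrite gtr0_norm ?subr_gt0 //; lra.
have s1 : s < 1.
  rewrite lt_neqAle; have /andP[_ ->] := Z01 _ Zs; rewrite andbT.
  by apply: contra_not_neq nQs => ->.
(* The bound [s + e], free by [Z_gap], makes the set of later vertex times closed, so its infimum is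
   attained and exceeds [s]. *)
pose B := Z `&` [set t | s + e <= t].
have clB : closed B by apply: closedI => //; exact: closed_ge.
have Z1 : Z 1 by apply: inZ; rewrite ?lexx ?ler01.
have B1 : B 1 by split => //; exact: Z_gap.
have lbB : lbound B (s + e) by move=> t [].
pose s' := inf B.
have [Zs' ss'] : B s' by apply: closed_inf_mem; [|exists 1|exists (s + e)].
have {}ss' : s < s' by apply: lt_le_trans ss'; rewrite ltrDl.
have gap t : s < t -> t < s' -> ~ vertex (c t).
  move=> st ts' vt; have := ts'; rewrite ltNge => /negP; apply.
  have Zt : Z t.
    apply: inZ vt; have /andP[_ s'1] := Z01 _ Zs'; apply/andP; split;
      first by rewrite (le_trans s0) // ltW.
    by rewrite (le_trans (ltW ts')).
  by apply: ge_inf; [exists (s + e) | split => //; exact: Z_gap].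
have s'1 : s' <= 1 by case/andP: (Z01 _ Zs').
have Qs' : Q (S s').
  by apply: contrapT => nQ; move: ss'; rewrite ltNge A_le.
have locE t : s < t -> t < s' -> exists i, open_edge i (c t).
  move=> st ts'; case lt: (loc (c t)) => [[i b]|]; first by exists i, b.
  by case: (gap t) => //; apply/loc_vertex.
have [||i E0] := locE ((s + s') / 2); [lra|lra|].
(* The image of []s, s'[] is connected and covered by the disjoint open edges, so its nonempty part
   in [open_edge i] is open and closed in it. *)
have cE t : s < t < s' -> open_edge i (c t).
  have := @connected_continuous_connected _ _ `]s, s'[ c.
  move=> conn /andP[st ts'].
  pose D := c @` `]s, s'[ `&` open_edge i.
  have DE : D = c @` `]s, s'[.
    apply: conn.
    - by apply/connected_intervalP; exact: interval_is_interval.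
    - apply: continuous_subspaceW c_cont => r /=;
        rewrite !in_itv /= => /andP[? ?].
      by apply/andP; split; lra.
    - exists (c ((s + s') / 2)); split => //; exists ((s + s') / 2) => //.
      by rewrite /= in_itv /=; apply/andP; split; lra.
    - by exists (open_edge i) => //; exact: open_edge_open.
    exists (~` \bigcup_(j in [set j | j != i]) open_edge j).
      by rewrite closedC; apply: bigcup_open => j _; exact: open_edge_open.
    apply/seteqP; split => [x [xc [b lx]]|x [[r rss' <-] nE]].
      by split => // -[j /= ji [b']]; rewrite lx => -[ij];
        rewrite ij eqxx in ji.
    split; first by exists r.
    move: rss'; rewrite /= in_itv /= => /andP[sr rs'].
    have [j Ej] := locE r sr rs'.
    have [<-//|ji] := eqVneq j i.
    by case: nE; exists j.
  have : (c @` `]s, s'[) (c t) by exists t => //=; rewrite in_itv /= st.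
  by rewrite -DE => -[].
(* The times [s + d] and [s' - d] are in order and within [e] of the ends; the sides on which [c]
   then lies name the vertices [c s] and [c s']. *)
pose d := Num.min e (s' - s) / 2.
have d_gt0 : 0 < d by rewrite divr_gt0 // lt_min e_gt0 subr_gt0.
have de : d < e.
  have : Num.min e (s' - s) <= e by rewrite ge_min lexx.
  by rewrite /d; move: e_gt0; move: (Num.min _ _) => m; lra.
have ds : 2 * d <= s' - s by rewrite /d mulrC divfK // ge_min lexx orbT.
have in01 t : s < t -> t < s' -> 0 <= t <= 1.
  by move=> st ts'; apply/andP; split; lra.
have t1s : s < s + d < s' by apply/andP; split; lra.
have t2s : s < s' - d < s' by apply/andP; split; lra.
have [[b1 l1] [b2 l2]] := (cE _ t1s, cE _ t2s).
case/andP: t1s => st1 t1s'; case/andP: t2s => st2 t2s'.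
have t101 := in01 _ st1 t1s'; have t201 := in01 _ st2 t2s'.
have dist1 : `|s + d - s| < e by rewrite addrC addKr gtr0_norm.
have dist2 : `|s' - (s' - d)| < e by rewrite opprB addrC subrK gtr0_norm.
have S1 : S (s + d) = S s.
  by apply: S_vertex => //; [exact: Z01 | left; case: Zs].
have S2 : S s' = S (s' - d).
  by apply: S_vertex => //; [exact: Z01 | right; case: Zs'].
have S12 : S (s' - d) = cross (@loc R G) (c (s + d)) (c (s' - d)) (S (s + d)).
  by apply: (S_open_edge s0 s'1 cE) => //; lra.
have cs : c s = param i b1%:R.
  have [U [_ gU] [Us Ut _]] := S_lift (Z01 _ Zs) t101 dist1.
  by apply: gU Us _ Ut l1; case: Zs.
have cs' : c s' = param i b2%:R.
  have [U [_ gU] [Ut Us _]] := S_lift t201 (Z01 _ Zs') dist2.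
  by apply: gU Us _ Ut l2; case: Zs'.
have b12 : b1 != b2.
  apply/eqP => b12; apply: nQs; move: Qs'; rewrite S2 S12 S1 /cross l1 l2 b12.
  by rewrite !eqxx.
(* The crossing runs towards the end [b2], which is therefore its orientation. *)
exists s, s', (i, b2); split => //.
- by move=> t t01 vt nQt; apply: A_le; split => //; exact: inZ.
- rewrite cs cs' /oparam /=; split.
  + by case: b1 b2 b12 {l1 l2 cs cs'} => [] []//= _; rewrite ?subr0.
  + by case: (b2); rewrite ?subrr.
  move=> _ [t /= + <-]; rewrite in_itv /= => /andP[].
  have b01 (b : bool) : 0 <= (b%:R : R) <= 1 by case: b; rewrite lexx ler01.
  rewrite le_eqVlt => /predU1P[<- _|st]; first by rewrite cs; exact: edge_param.
  rewrite le_eqVlt => /predU1P[->|ts']; first by rewrite cs'; exact: edge_param.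
  have [|b /loc_some[r [/andP[r0 r1] -> _]]] := cE t; first by rewrite st.
  by apply: edge_param; rewrite !ltW.
split => //; rewrite S2 S12 S1 /cross l1 l2 eqxx b12 //=.
Qed.

End LastCrossing.

(** * Crossings of all edges of the reduced path *)

Section PathCrossings.
Variables (R : realType) (G : graph R).

(** Apply [last_crossing] to the property that the first [l.+1] letters of [p] are acquired;
    [push_prefix] shows that the edge crossed is the [l]-th. At the end of that crossing the word is
    exactly this prefix, too short for any later [m], so the maximality of the [m]-th start orders
    the crossings. *)
Lemma path_crossings (c d : R -> G) (p : seq (oedge G)) :
    {within `[0, 1], continuous c} -> vertex (c 0) -> vertex (c 1) ->
    path_homotopic c d -> constant_speed p d -> reduced p ->
  exists a b : 'I_(size p) -> R,
  [/\ forall l, [/\ 0 <= a l, a l < b l & b l <= 1],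
      forall l m : 'I_(size p), (l < m)%N -> b l <= a m &
      forall l, let o := tnth (in_tuple p) l in
        [/\ c (a l) = oparam o 0, c (b l) = oparam o 1 &
            c @` `[a l, b l] `<=` edge o.1]].
Proof.
move=> c_cont c0 c1 /path_lift[e [N0 [e_gt0 lift]]] d_speed p_red.
case: (posnP (size p)) => [p0|p_gt0].
  by exists (fun=> 0), (fun=> 0); split=> -[l lt_lp]; exfalso;
    rewrite p0 in lt_lp.
(* A multiple of [size p] aligns the samples with the edges of [d]; the factor [N0.+3] exceeds [N0]
   and gives more than two steps per edge. *)
have [||S [S0 S1 S_red S_lift]] := lift (size p * N0.+3)%N.
- by apply: leq_trans (leq_pmull _ p_gt0); lia.
- by rewrite muln_gt0 p_gt0.
rewrite (constant_speed_monodromy d_speed p_red) // in S1.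
have /choice[F FP] (l : 'I_(size p)) : exists ss : R * R,
    let o := tnth (in_tuple p) l in
  [/\ [/\ 0 <= ss.1, ss.1 < ss.2 & ss.2 <= 1],
      forall t, 0 <= t <= 1 -> vertex (c t) ->
        ~~ prefix (take l.+1 p) (rev (S t)) -> t <= ss.1,
      [/\ c ss.1 = oparam o 0, c ss.2 = oparam o 1 &
          c @` `[ss.1, ss.2] `<=` edge o.1] &
      rev (S ss.2) = take l.+1 p].
  pose Q (w : seq ('I_(n_edges G) * bool)) :=
    is_true (prefix (take l.+1 p) (rev w)).
  have [||s [s' [a [ss' s_max cross_a nQs [Qs' Ss']]]]] :=
    last_crossing c_cont e_gt0 c0 c1 S_red S_lift (Q := Q).
  - by rewrite /Q S0 prefixs0 -size_eq0 size_takel.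
  - by rewrite /Q S1 revK prefix_take.
  have := Qs'; rewrite /Q Ss' => /(push_prefix (introN idP nQs))[take_p pushE].
  have aE : a = tnth (in_tuple p) l.
    have := take_p; rewrite (take_nth a (ltn_ord l)) pushE rev_cons =>
      /rcons_inj[_ aE].
    by rewrite (tnth_nth a) -[LHS]aE.
  exists (s, s'); rewrite -aE; split => //=; last by rewrite Ss'.
  by move=> t t01 vt /negP; exact: s_max.
exists (fun l => (F l).1), (fun l => (F l).2); split.
- by move=> l; case: (FP l).
- move=> l m lt_lm; have [[_ _ l1] _ [_ cl _] Sl] := FP l.
  have [_ m_max _ _] := FP m; apply: m_max.
  + by have [[l0 /ltW ll _] _ _ _] := FP l; rewrite (le_trans l0).
  + by rewrite cl; exact: vertex_oparam1.
  rewrite Sl; apply/negP => /size_prefix; rewrite !size_takel //; lia.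
by move=> l; case: (FP l).
Qed.

End PathCrossings.

(** * Laps and horseshoes *)

Section Horseshoes.
Variables (R : realType) (G : graph R).
Implicit Types (o : oedge G) (i j : 'I_(n_edges G)).

(** The inverse of the parametrization, reversed along with [o], turns [c] into a real function from
    0 to 1, to which [itv_pullback] applies. *)
Lemma oparam_pullback (c : R -> G) o (a b u v : R) :
    a <= b -> {within `[a, b], continuous c} ->
    c a = oparam o 0 -> c b = oparam o 1 -> c @` `[a, b] `<=` edge o.1 ->
    0 <= u -> u < v -> v <= 1 ->
  exists a' b', [/\ a <= a', a' < b', b' <= b,
    oparam o @` `[u, v] `<=` c @` `[a', b'] &
    c @` `]a', b'[ `<=` oparam o @` `]u, v[].
Proof.
move=> ab c_cont ca cb cE u0 uv v1.
have [_ _ [h [h_cont hK]]] := param_homeo o.1.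
pose h' x := if o.2 then h x else 1 - h x.
have ho t : 0 <= t <= 1 -> h' (oparam o t) = t.
  rewrite /h' /oparam => /andP[t0 t1].
  case: (o.2) => /=; rewrite hK ?subKr //= in_itv /=; apply/andP; split; lra.
have oh x : edge o.1 x -> oparam o (h' x) = x.
  move=> /edgeP[t t01 ->]; rewrite /oparam /h' hK; last by rewrite /= in_itv.
  by case: (o.2); rewrite ?subKr.
have h'_cont : {within edge o.1, continuous h'}.
  rewrite /h'; case: (o.2) => //.
  by apply: within_continuousB => //;
    exact: continuous_subspaceT (@cst_continuous _ _ _).
have g_cont : {within `[a, b], continuous h' \o c}.
  apply/subspace_continuousP => x xab U nU.
  have := (subspace_continuousP _ _).1 h'_cont (c x) (cE _ (imageP c xab)) U nU.
  move/((subspace_continuousP _ _).1 c_cont x xab).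
  rewrite /= /nbhs /= /within /=; apply: filterS => t /= ct tab.
  by apply: ct => //; apply: cE; exists t.
have [||a' [b' [aa' a'b' b'b sub_uv in_uv]]] :=
  itv_pullback ab g_cont _ uv _ (u := u) (v := v).
- by rewrite /= ca ho ?lexx ?ler01.
- by rewrite /= cb ho ?lexx ?ler01.
have cE' t : a' <= t <= b' -> edge o.1 (c t).
  move=> /andP[a't tb']; apply: cE; exists t => //=.
  by rewrite in_itv /= (le_trans aa') ?(le_trans tb').
exists a', b'; split => // _ [t tI <-].
  have [s sI gs] := sub_uv t tI; exists s => //; rewrite -gs /= oh //.
  by apply: cE'; rewrite /= in_itv in sI.
exists (h' (c t)); first by apply: in_uv; exists t.
by apply: oh; apply: cE'; move: tI; rewrite /= in_itv /= => /andP[? ?];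
  rewrite !ltW.
Qed.

Lemma crossing_pullback (c : R -> G) o (a b u v : R) :
    a <= b -> {within `[a, b], continuous c} ->
    c a = oparam o 0 -> c b = oparam o 1 -> c @` `[a, b] `<=` edge o.1 ->
    0 <= u -> u < v -> v <= 1 ->
  exists a' b', [/\ a <= a', a' < b', b' <= b,
    subarc o.1 u v `<=` c @` `[a', b'] &
    c @` `]a', b'[ `<=` param o.1 @` `]u, v[].
Proof.
case: o => i [] /= ab c_cont ca cb cE u0 uv v1.
  exact: (oparam_pullback ab c_cont ca cb cE).
have [|||a' [b' [aa' a'b' b'b sub_uv in_uv]]] :=
  oparam_pullback ab c_cont ca cb cE (u := 1 - v) (v := 1 - u); try lra.
exists a', b'; split => // [x [t tuv <-]|x /in_uv[t tuv <-]].
  apply: sub_uv; exists (1 - t); last by rewrite /oparam /= subKr.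
  by move: tuv; rewrite /= !in_itv /= => /andP[? ?]; apply/andP; split; lra.
exists (1 - t) => //.
by move: tuv; rewrite /= !in_itv /= => /andP[? ?]; apply/andP; split; lra.
Qed.

(** Unlike in a horseshoe, the edges [j] and [i] may differ, which allows an induction along
    walks. *)
Definition laps (g : G -> G) j i n := exists a b : 'I_n -> R,
  [/\ forall l, [/\ 0 <= a l, a l < b l & b l <= 1],
      forall l m, l != m -> `]a l, b l[ `&` `]a m, b m[ = set0 &
      forall l, edge i `<=` g @` subarc j (a l) (b l)].

Lemma laps_horseshoe g i n : laps g i i n -> has_horseshoe g n i.
Proof.
case=> a [b [ab disj cov]]; exists a, b; split => //.
  by move=> l; have [? ? ?] := ab l.
move=> x [l _ [t /= tab <-]] m _; apply: cov; apply: edge_param.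
have [al _ bl] := ab l; move: tab; rewrite in_itv /= => /andP[lt tl].
by rewrite (le_trans al) ?(le_trans tl).
Qed.

Lemma laps_fin g j i (T : finType) (a b : T -> R) :
    (forall l, [/\ 0 <= a l, a l < b l & b l <= 1]) ->
    (forall l m, l != m -> `]a l, b l[ `&` `]a m, b m[ = set0) ->
    (forall l, edge i `<=` g @` subarc j (a l) (b l)) ->
  laps g j i #|T|.
Proof.
move=> ab disj cov; exists (a \o enum_val), (b \o enum_val).
split=> [l|l m lm|l]; [exact: ab| |exact: cov].
by apply: disj; apply: contra lm => /eqP/enum_val_inj ->.
Qed.

Variables (f : G -> G) (p : 'I_(n_edges G) -> seq (oedge G)).
Hypothesis f_cont : continuous f.
Hypothesis f_cross : forall j, exists a b : 'I_(size (p j)) -> R,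
  [/\ forall l, [/\ 0 <= a l, a l < b l & b l <= 1],
      forall l m : 'I_(size (p j)), (l < m)%N -> b l <= a m &
      forall l, let o := tnth (in_tuple (p j)) l in
        [/\ f (param j (a l)) = oparam o 0, f (param j (b l)) = oparam o 1 &
            (f \o param j) @` `[a l, b l] `<=` edge o.1]].

Let path_cont j : {within `[0, 1], continuous (f \o param j)}.
Proof.
apply: within_continuous_comp; first by move=> x _; exact: f_cont.
by have [] := param_homeo j.
Qed.

(** Laps of [iter k f] on each edge that [f] crosses along [j] are pulled back through the crossing.
    Intervals from different crossings are separated by the order of the crossings; within one
    crossing, their interiors map into disjoint interiors. *)
Lemma laps_walks k j i :
  laps (iter k f) j i (walks (fun j => [seq o.1 | o <- p j]) k j i).
Proof.
set out := fun j => _; elim: k j => [|k IHk] j.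
  rewrite /=; have [->|_] := eqVneq j i; last by exists (fun=> 0), (fun=> 0);
    split => -[].
  exists (fun=> 0), (fun=> 1); split => [_|l m|_ x].
  - by rewrite ltr01 !lexx.
  - by rewrite !ord1.
  by move=> /edgeP[t t01 ->]; exists (param i t) => //; exists t => //=;
    rewrite in_itv.
have [a [b [ab ab_lt abE]]] := f_cross j.
pose o l := tnth (in_tuple (p j)) l; pose n h := walks out k h i.
pose A h : 'I_(n h) -> R := projT1 (cid (IHk h)).
pose B h : 'I_(n h) -> R := projT1 (cid (projT2 (cid (IHk h)))).
have ABP h : [/\ forall q, [/\ 0 <= A h q, A h q < B h q & B h q <= 1],
    forall q r, q != r -> `]A h q, B h q[ `&` `]A h r, B h r[ = set0 &
    forall q, edge i `<=` iter k f @` subarc h (A h q) (B h q)].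
  exact: projT2 (cid (projT2 (cid (IHk h)))).
(* The new laps are indexed by a crossing [l] and a lap of [iter k f] on the edge it crosses. *)
have -> : walks out k.+1 j i = #|{: {l : 'I_(size (p j)) & 'I_(n (o l).1)}}|.
  rewrite card_tagged sumnE big_map big_enum /= /out big_map big_tnth.
  by apply: eq_bigr => l _; rewrite card_ord.
have /choice[F FP] (x : {l : 'I_(size (p j)) & 'I_(n (o l).1)}) :
    exists ab' : R * R,
  [/\ a (tag x) <= ab'.1, ab'.1 < ab'.2, ab'.2 <= b (tag x),
      subarc (o (tag x)).1 (A _ (tagged x)) (B _ (tagged x)) `<=`
        (f \o param j) @` `[ab'.1, ab'.2] &
      (f \o param j) @` `]ab'.1, ab'.2[ `<=`
        param (o (tag x)).1 @` `]A _ (tagged x), B _ (tagged x)[].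
  case: x => l q /=; have [a0 alb b1] := ab l; have [ca cb cE] := abE l.
  have [/(_ q)[A0 AB B1] _ _] := ABP (o l).1.
  have [|a' [b' ?]] := @crossing_pullback (f \o param j) _ _ _ _ _ (ltW alb) _
    ca cb cE A0 AB B1; last by exists (a', b').
  apply: continuous_subspaceW (@path_cont j) => t /=.
  by rewrite !in_itv /= => /andP[at_ tb];
    rewrite (le_trans a0) // (le_trans tb).
apply: (@laps_fin _ _ _ _ (fun x => (F x).1) (fun x => (F x).2)).
- move=> x; have [? ? ? _ _] := FP x; have [? _ ?] := ab (tag x).
  by split => //; lra.
- move=> x y xy; rewrite -subset0 => t [tx ty].
  have lt_disj (x' y' : {l : 'I_(size (p j)) & 'I_(n (o l).1)}) :
      (tag x' < tag y')%N ->
      t \in `](F x').1, (F x').2[ -> t \in `](F y').1, (F y').2[ -> False.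
    move=> /ab_lt le_ba; have [_ _ x2 _ _] := FP x'; have [y1 _ _ _ _] := FP y'.
    by rewrite !in_itv /= => /andP[_ tx'] /andP[ty' _]; lra.
  have [lt|lt|tag_xy] := ltngtP (tag x) (tag y);
    [exact: (lt_disj x y)|exact: (lt_disj y x)|].
  have [_ _ _ _ inx] := FP x; have [_ _ _ _ iny] := FP y.
  have := inx _ (imageP _ tx); have := iny _ (imageP _ ty).
  move/val_inj: tag_xy xy {inx iny tx ty lt_disj}; case: x y => l q [m r] /= lm.
  move: r; rewrite -{m}lm => r qr [t1 t1r <-] [t2 t2q].
  have [AB01 AB_disj _] := ABP (o l).1.
  have in01 (q' : 'I_(n (o l).1)) s : s \in `]A _ q', B _ q'[ -> 0 <= s <= 1.
    have [A0 AB B1] := AB01 q'; rewrite in_itv /= => /andP[As sB].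
    by apply/andP; split; lra.
  move=> /(param_inj (in01 _ _ t2q) (in01 _ _ t1r)) t21; rewrite t21 in t2q.
  suff qr' : q != r by have := AB_disj _ _ qr'; rewrite -subset0; apply; split;
    [exact: t2q|exact: t1r].
  by apply: contra qr => /eqP ->.
move=> x y yE; have [_ _ _ cov _] := FP x.
have [_ _ /(_ (tagged x) y yE)[z zAB zy]] := ABP (o (tag x)).1.
have [t tF tz] := cov z zAB.
by exists (param j t); [exists t | rewrite iterSr -zy -tz].
Qed.

End Horseshoes.

(** * Laps of the linearization *)

Section MarkovMatrix.
Variables (R : realType) (G : graph R).
Implicit Types (o : oedge G) (i j : 'I_(n_edges G)).

Lemma oparam_inj o (s t : R) : 0 <= s <= 1 -> 0 <= t <= 1 ->
  oparam o s = oparam o t -> s = t.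
Proof.
move=> s01 t01; rewrite /oparam; case: (o.2); first exact: param_inj.
move=> /param_inj st; suff : 1 - s = 1 - t by lra.
by apply: st; apply/andP; split; lra.
Qed.

Lemma oparam_interior o i (u : R) : 0 < u < 1 -> edge i (oparam o u) -> o.1 = i.
Proof.
move=> /andP[u0 u1] /edgeP[t t01]; rewrite /oparam;
  case: (o.2) => /param_interior_neq; apply=> //.
  by rewrite u0.
by apply/andP; split; lra.
Qed.

Lemma edge_oparam o (u : R) : 0 <= u <= 1 -> edge o.1 (oparam o u).
Proof.
move=> /andP[u0 u1]; rewrite /oparam; case: (o.2); apply: edge_param;
  first by rewrite u0.
by apply/andP; split; lra.
Qed.

(** Write [m] for [size p] and [k] for the integer part of [a m]. If [b] passed [k.+1 / m], two
    successive edges of the path would both be [i]: with equal orientations the ends of [i] would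
    coincide, with opposite ones injectivity would fail. So [[a, b]] lies in one lap, and
    surjectivity makes it the whole lap. *)
Lemma constant_speed_lap (g : G -> G) j (p : seq (oedge G)) i (a b : R) :
    (0 < size p)%N -> constant_speed p (g \o param j) ->
    0 <= a -> a <= b -> b <= 1 -> set_bij (subarc j a b) (edge i) g ->
  exists k : 'I_(size p), [/\ (tnth (in_tuple p) k).1 = i,
    a = k%:R / (size p)%:R & b = k.+1%:R / (size p)%:R].
Proof.
move=> p_gt0 cp a0 ab b1 [g_fun g_inj g_surj]; set m := (size p)%:R : R.
have m_gt0 : 0 < m by rewrite ltr0n.
have m_neq0 : m != 0 by rewrite gt_eqF.
pose c := g \o param j.
have cE t : a <= t <= b -> edge i (c t).
  by move=> tab; apply: g_fun; exists t => //=; rewrite in_itv.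
have c_inj s t : a <= s <= b -> a <= t <= b -> c s = c t -> s = t.
  move=> /andP[as_ sb] /andP[at_ tb] /g_inj st; apply: (@param_inj _ _ j).
  - by rewrite (le_trans a0) ?(le_trans sb).
  - by rewrite (le_trans a0) ?(le_trans tb).
  by apply: st; apply/mem_set; [exists s | exists t];
    rewrite //= in_itv /= ?as_ ?at_.
have c_surj x : edge i x -> exists2 t, a <= t <= b & c t = x.
  by move=> /g_surj[_ [t + <-] <-]; rewrite /= in_itv => tab; exists t.
have {}ab : a < b.
  rewrite lt_neqAle ab andbT; apply/eqP => abE.
  have eb (e : bool) : edge i (param i e%:R) by apply: edge_param; case: e;
    rewrite lexx ler01.
  have [t0 + ct0] := c_surj _ (eb false); have [t1 + ct1] := c_surj _ (eb true).
  rewrite -abE -!eq_le => /eqP t1a /eqP t0a.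
  by have := @paramb_inj _ _ i true false;
    rewrite -ct0 -ct1 -t1a -t0a => /(_ erefl).
pose k := Num.truncn (a * m).
have /andP[ka ak] : k%:R <= a * m < k.+1%:R by apply: truncn_itv;
  rewrite mulr_ge0 // ltW.
have lt_km : (k < size p)%N.
  by rewrite -(ltr_nat R) (le_lt_trans ka) // -/m -[ltRHS]mul1r ltr_pM2r //
    (lt_le_trans ab).
pose o := tnth (in_tuple p) (Ordinal lt_km).
have co u : 0 <= u <= 1 -> c ((k%:R + u) / m) = oparam o u.
  by move=> u01; exact: (cp (Ordinal lt_km)).
have bk : b * m <= k.+1%:R.
  rewrite leNgt; apply/negP => kb.
  have lt_k1m : (k.+1 < size p)%N.
    by rewrite -(ltr_nat R) (lt_le_trans kb) // -/m -[leRHS]mul1r ler_wpM2r //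
      ltW.
  pose o' := tnth (in_tuple p) (Ordinal lt_k1m).
  have co' u : 0 <= u <= 1 -> c ((k.+1%:R + u) / m) = oparam o' u.
    by move=> u01; exact: (cp (Ordinal lt_k1m)).
  (* Small enough for the two times at distance [u / m] from the break [k.+1 / m] to stay in
     [[a, b]]. *)
  have [u [u0 u1 ua ub]] : exists u : R, [/\ 0 < u, u < 1,
    u < k.+1%:R - a * m & u < b * m - k.+1%:R].
    pose v := Num.min 1 (Num.min (k.+1%:R - a * m) (b * m - k.+1%:R)).
    have v0 : 0 < v by rewrite !lt_min ltr01 !subr_gt0 ak.
    have [v1 va vb] : [/\ v <= 1, v <= k.+1%:R - a * m & v <= b * m - k.+1%:R].
      by rewrite /v; split; rewrite !ge_min lexx ?orbT.
    by exists (v / 2); split; lra.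
  have t1_in : a <= (k%:R + (1 - u)) / m <= b.
    by rewrite -natr1 in ua ub; rewrite ler_pdivlMr // ler_pdivrMr //;
      apply/andP; split; lra.
  have t2_in : a <= (k.+1%:R + u) / m <= b.
    by rewrite ler_pdivlMr // ler_pdivrMr //; apply/andP; split; lra.
  have ct1 : c ((k%:R + (1 - u)) / m) = oparam o (1 - u) by apply: co;
    apply/andP; split; lra.
  have ct2 : c ((k.+1%:R + u) / m) = oparam o' u by apply: co'; apply/andP;
    split; lra.
  have oi : o.1 = i.
    by have := cE _ t1_in; rewrite ct1; apply: oparam_interior; apply/andP;
      split; lra.
  have o'i : o'.1 = i.
    by have := cE _ t2_in; rewrite ct2; apply: oparam_interior; apply/andP;
      split; lra.
  have o1o'0 : oparam o 1 = oparam o' 0.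
    by rewrite -co ?lexx ?ler01 // -co' ?lexx ?ler01 // addr0 natr1.
  have := c_inj _ _ t1_in t2_in; rewrite ct1 ct2.
  move: o1o'0; rewrite /oparam oi o'i.
  have [oo'|] := eqVneq o.2 o'.2.
    rewrite oo'; case: (o'.2); rewrite ?subr0 ?subrr.
      by move/(@paramb_inj _ _ i true false).
    by move/(@paramb_inj _ _ i false true).
  case: (o.2) (o'.2) => [] []//= _ _;
    rewrite ?subKr => /(_ erefl)/(mulIf (invr_neq0 m_neq0)); rewrite -natr1;
      lra.
have co_ t : a <= t <= b -> c t = oparam o (t * m - k%:R).
  move=> /andP[at_ tb]; have /andP[t1 t2] : a * m <= t * m <= b * m by rewrite
    !ler_pM2r // at_.
  rewrite -co; first by congr c; field.
  by rewrite -natr1 in bk; apply/andP; split; lra.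
have oi : o.1 = i.
  have tab : a <= (a + b) / 2 <= b by apply/andP; split; lra.
  have := cE _ tab; rewrite co_ //; apply: oparam_interior.
  have ltm : a * m < b * m by rewrite ltr_pM2r.
  by rewrite -natr1 in bk; apply/andP; split; lra.
have ends (u : R) : 0 <= u <= 1 -> a <= (k%:R + u) / m <= b.
  move=> u01; have [|t tab] := c_surj (oparam o u); first by rewrite -oi;
    exact: edge_oparam.
  rewrite co_ // => /oparam_inj tu; have <- : t = (k%:R + u) / m; last by [].
  rewrite -tu //; first by field.
  case/andP: tab => at_ tb; have /andP[t1 t2] : a * m <= t * m <= b * m by
    rewrite !ler_pM2r // at_.
  by rewrite -natr1 in bk; apply/andP; split; lra.
have /andP[a_le _] := ends 0 (introT andP (conj (lexx _) ler01)).
have /andP[_ b_ge] := ends 1 (introT andP (conj ler01 (lexx _))).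
rewrite addr0 in a_le; rewrite natr1 in b_ge.
exists (Ordinal lt_km); split => //=; apply/eqP; rewrite eq_le.
  by rewrite ler_pdivrMr // ka a_le.
by rewrite ler_pdivlMr // bk b_ge.
Qed.

(** By [constant_speed_lap], every subarc counted by the matrix is in the list of laps over [i]. *)
Lemma markov_le_count (g : G -> G) (p : 'I_(n_edges G) -> seq (oedge G)) i j :
    (0 < size (p j))%N -> constant_speed (p j) (g \o param j) ->
  0 <= markov_matrix g i j <= (count_mem i [seq o.1 | o <- p j])%:R.
Proof.
move=> p_gt0 cp; rewrite mxE ler0n ler_nat.
pose lap (k : nat) :=
  subarc j (k%:R / (size (p j))%:R) (k.+1%:R / (size (p j))%:R).
pose s := [seq lap k | k : 'I_(size (p j)) <- enum 'I_(size (p j)) &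
  (tnth (in_tuple (p j)) k).1 == i].
have -> : count_mem i [seq o.1 | o <- p j] = size s.
  rewrite size_map size_filter count_map.
  by rewrite -{1}[p j](map_tnth_enum (in_tuple (p j))) count_map.
set X := (X in fset_set X).
have Xs : X `<=` [set` [fset J in s]%fset].
  move=> J [[a [b [a0 ab b1 ->]]] [bij _ _]] /=.
  have [k [ki -> ->]] := constant_speed_lap p_gt0 cp a0 ab b1 bij.
  rewrite in_fset_; apply/mapP.
  by exists k => //; rewrite mem_filter ki eqxx mem_enum.
(* Finiteness ensures that [fset_set X] has the elements of [X] and not the default empty value. *)
have finX : finite_set X by apply: sub_finite_set Xs _; exact: finite_fset.
apply: (@leq_trans #|` [fset J in s]%fset|).
  by apply: fsubset_leq_card; apply/fsubsetP => J;
    rewrite in_fset_set // => /set_mem /Xs.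
by rewrite card_fseq size_undup.
Qed.

End MarkovMatrix.

(** * From entropy to horseshoes *)

Theorem theorem10 (R : realType) (G : graph R) (f L : G -> G)
    (f_vertex_map : vertex_map f) (L_lin : linearization f L)
    (h_gt0 : 0 < entropy L) (s : R) (s_gt0 : 0 < s) (s_lt : s < entropy L) :
  exists (E : 'I_(n_edges G)) (k n : nat),
    [/\ (0 < k)%N, (0 < n)%N, s < k%:R^-1 * ln n%:R
      & has_horseshoe (iter k f) n E].
Proof.
have [f_cont [f_fun f_inj _]] := f_vertex_map.
have [_ /choice[p pP]] := L_lin.
(* An empty path would make [f] identify the two distinct ends of an edge. *)
have p_gt0 i : (0 < size (p i))%N.
  have [p_path _ _ _] := pP i; rewrite lt0n size_eq0; apply/negP => /eqP p0.
  move: p_path; rewrite p0 /= => /f_inj p01.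
  by have := @paramb_inj _ _ i false true (p01 (mem_set (vertex_param0 i))
    (mem_set (vertex_param1 i))).
pose out i := [seq o.1 | o <- p i].
have count i j : 0 <= markov_matrix L i j <= (count_mem i (out j))%:R.
  by have [_ _ p_speed _] := pP j; exact: markov_le_count.
(* As [ln] is 0 on nonpositive reals, positive entropy excludes a nonpositive radius. *)
have radius_gt0 : 0 < spectral_radius (markov_matrix L).
  rewrite ltNge; apply/negP => /ln0 ln_le0.
  by move: h_gt0; rewrite /entropy ln_le0 ltxx.
have [||i [k [k_gt0 lt_walks]]] := spectral_radius_walks count (r := expR s).
- exact: expR_gt0.
- by rewrite -[ltRHS]lnK ?posrE // ltr_expR.
have walks_gt0 : 0 < (walks out k i i)%:R :> R.
  by apply: lt_trans lt_walks; rewrite exprn_gt0 // expR_gt0.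
exists i, k, (walks out k i i); split => //.
- by rewrite -(ltr0n R).
- rewrite ltr_pdivlMl ?ltr0n // -ltr_expR lnK ?posrE //.
  by rewrite expRM_natl.
apply: laps_horseshoe; apply: laps_walks => // j.
have [_ p_red p_speed fL] := pP j.
apply: path_crossings fL p_speed p_red.
- apply: within_continuous_comp; first by move=> x _; exact: f_cont.
  by have [] := param_homeo j.
- by apply: f_fun; exact: vertex_param0.
by apply: f_fun; exact: vertex_param1.
Qed.
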